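(* Let $f,h_1,\dots,h_m\in\mathbb{R}[x]=\mathbb{R}[x_1,\dots,x_n]$ and $b=(b_1,\dots,b_m)\in\mathbb{R}^m$. Let $X\subset\mathbb{R}^n$ be a compact set, and suppose that one of the following two cases holds: (i) $X=\{x\in\mathbb{R}^n\mid p_1(x)=\dots=p_s(x)=0,\ g_1(x)\ge 0\}$ with $p_1,\dots,p_s\in\mathbb{R}[x]$ and $g_1=R-\|x\|^2$ for some $R>0$, where $\{x\in\mathbb{R}^n\mid p_1(x)=\dots=p_s(x)=0\}\subset\{x\in\mathbb{R}^n\mid g_1(x)>0\}$; the ideal $I(\mathbf{p})=(p_1,\dots,p_s)$ is real radical; and $\mathbf{p}=\{p_1,\dots,p_s\}$ is a Gröbner basis of $I(\mathbf{p})$ with respect to the graded lexicographic order. In this case put $\mathbf{g}=\{g_1\}$ and $\ell=1$. (ii) $X=\{x\in\mathbb{R}^n\mid g_1(x)\ge0,\dots,g_\ell(x)\ge 0\}$ with $g_1,\dots,g_\ell\in\mathbb{R}[x]$ and $g_1=R-\|x\|^2$ for some $R>0$, and $X$ has nonempty interior. In this case put $\mathbf{g}=\{g_1,\dots,g_\ell\}$ and $\mathbf{p}=\{0\}$. Assume further that $h_1\equiv 1$, $b_1>0$, and that $b$ is in the relative interior of the cone $$K=\Big\{\Big(\int_X h_i\,d\mu\Big)_{i=1,\dots,m}\ \Big|\ \mu\in\mathcal{M}_+(X)\Big\}.$$ Then for every integer $t\ge t_{\min}$ the semidefinite program $$\mathrm{D}_t=\sup_{\lambda\in\mathbb{R}^m}\Big\{\sum_{i=1}^m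 b_i\lambda_i\ :\ f-\sum_{i=1}^m \lambda_i h_i\in \mathrm{QM}_{2t}(\mathbf{g})+\langle\mathbf{p}\rangle_{2t}\Big\}$$ attains its optimal value, i.e. the supremum is a maximum.
   Context: $\mathcal{M}_+(X)$ is the set of finite nonnegative Borel measures supported on $X$; relative interior means interior within the affine hull. $\mathbb{R}[x]_d$ is the space of polynomials of degree at most $d$, and $\Sigma[x]_{2t}$ is the set of sums of squares of polynomials having degree at most $2t$. For a polynomial $k$ write $t_k=\lceil \deg(k)/2\rceil$. The truncated quadratic module is $$\mathrm{QM}_{2t}(\mathbf{g})=\Big\{\sigma_0+\sum_{j=1}^{\ell}\sigma_j g_j\ \Big|\ \sigma_0\in\Sigma[x]_{2t},\ \sigma_j\in\Sigma[x]_{2(t-t_{g_j})}\Big\},$$ and the truncated ideal is $$\langle\mathbf{p}\rangle_{2t}=\Big\{\sum_{l=1}^s k_lp_l\ \Big|\ k_l\in\mathbb{R}[x],\ \deg(k_lp_l)\le 2t\Big\},$$ which is $\{0\}$ when $\mathbf{p}=\{0\}$. The integer $t_{\min}$ is the maximum of $t_{g_1},\dots,t_{g_\ell}$, $t_{p_1},\dots,t_{p_s}$ (these last only in case (i)), $t_{h_1},\dots,t_{h_m}$ and $t_f$. An ideal $I\subseteq\mathbb{R}[x]$ is real radical if $I=\{k\in\mathbb{R}[x]\mid k^{2a}+\sigma\in I\text{ for some integer }a\ge 1\text{ and some sum of squares }\sigma\}$. The graded lexicographic order compares monomials first by total degree, ties being broken lexicographically with $x_n<\dots<x_1$. A finite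 subset $\mathcal{G}$ of an ideal $I$ is a Gröbner basis of $I$ if the leading term of every nonzero element of $I$ is divisible by the leading term of some element of $\mathcal{G}$. *)

(* Defs.v *)
From HB Require Import structures.
From mathcomp Require Import all_boot all_order all_algebra.
From mathcomp Require Import all_classical all_reals all_analysis.
(* The notations of mpoly clash with those of mathcomp-analysis; those that are
   needed are restated below. *)
From mathcomp Require Import -(notations) mpoly.

Set Implicit Arguments.
Unset Strict Implicit.
Unset Printing Implicit Defensive.

Import Order.TTheory GRing.Theory Num.Theory.
Import numFieldTopology.Exports numFieldNormedType.Exports.

Local Open Scope classical_set_scope.
Local Open Scope ring_scope.

Notation "{ 'mpoly' T [ n ] }" := (mpoly n T)
  (at level 0, T, n at level 2, format "{ 'mpoly'  T [ n ] }") : type_scope.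
Notation "c %:MP" := (mpolyC _ c) (at level 1, format "c %:MP") : ring_scope.
Notation "p .@[ x ]" := (meval x p)
  (at level 1, format "p .@[ x ]") : ring_scope.

Section polynomials.
Variables (R : realType) (n : nat).
Implicit Types (p q k : {mpoly R[n]}) (I : set {mpoly R[n]}).

(* [mmeasure] is 1 + the degree, or 0 for the zero polynomial, which thus has
   degree 0 here. *)
Definition mdegree p : nat := (mmeasure (@mdeg n) p).-1.

Definition half_degree p : nat := uphalf (mdegree p).

Definition is_sos : set {mpoly R[n]} :=
  [set p | exists qs : seq {mpoly R[n]}, p = \sum_(q <- qs) q ^+ 2].

Definition sos_deg (d : nat) : set {mpoly R[n]} :=
  [set p | is_sos p /\ (mdegree p <= d)%N].

Definition trunc_qmodule (t l : nat) (g : 'I_l -> {mpoly R[n]}) :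
    set {mpoly R[n]} :=
  [set q | exists (sigma0 : {mpoly R[n]}) (sigma : 'I_l -> {mpoly R[n]}),
    [/\ sos_deg (2 * t) sigma0,
        forall j, sos_deg (2 * (t - half_degree (g j))) (sigma j)
      & q = sigma0 + \sum_j sigma j * g j]].

Definition trunc_ideal (t s : nat) (p : 'I_s -> {mpoly R[n]}) :
    set {mpoly R[n]} :=
  [set q | exists k : 'I_s -> {mpoly R[n]},
    (forall l, (mdegree (k l * p l)%R <= 2 * t)%N) /\ q = \sum_l k l * p l].

Definition ideal_gen (s : nat) (p : 'I_s -> {mpoly R[n]}) :
    set {mpoly R[n]} :=
  [set q | exists k : 'I_s -> {mpoly R[n]}, q = \sum_l k l * p l].

Definition real_radical I : Prop :=
  I = [set k | exists (a : nat) (sigma : {mpoly R[n]}),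
         [/\ (1 <= a)%N, is_sos sigma & I (k ^+ (2 * a) + sigma)]].

(* The order on monomials underlying [mlead], although documented as degrevlex,
   is the graded lexicographic one in which the variable of index 0 is the
   largest: see [lt_mdeg_ltmc] and [ltmcP] in mpoly.  The zero polynomial has
   no leading term, but [mlead 0] is the monomial 1, which divides everything:
   it has to be excluded explicitly. *)
Definition groebner_basis (s : nat) (p : 'I_s -> {mpoly R[n]}) I : Prop :=
  (forall l, I (p l)) /\
  forall q, I q -> q != 0 ->
    exists l, p l != 0 /\ forall i, (mlead (p l) i <= mlead q i)%N.

Definition ball_poly (r : R) : {mpoly R[n]} :=
  r%:MP - \sum_i mpolyX R (mnm1 i) ^+ 2.

End polynomials.

Section moments.
Variables (R : realType) (n : nat).

Definition semialg_set (s l : nat) (p : 'I_s -> {mpoly R[n]})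
    (g : 'I_l -> {mpoly R[n]}) : set 'rV[R]_n :=
  [set x | (forall k, (p k).@[x ord0] = 0) /\ (forall j, 0 <= (g j).@[x ord0])].

Definition borel_space := g_sigma_algebraType (@open 'rV[R]_n).

Definition affine_hull (V : lmodType R) (A : set V) : set V :=
  [set y | exists (k : nat) (c : 'I_k -> R) (x : 'I_k -> V),
    [/\ forall i, A (x i), \sum_i c i = 1 & y = \sum_i c i *: x i]].

Definition relative_interior (m : nat) (A : set 'rV[R]_m) : set 'rV[R]_m :=
  (A : set (subspace (affine_hull A)))^°.

(* For a closed set [X], the support of [mu] is included in [X] iff the
   complement of [X] is [mu]-null. *)
Definition measures_on (X : set 'rV[R]_n) :
    set {finite_measure set borel_space -> \bar R} :=
  [set mu : {finite_measure set borel_space -> \bar R} | mu (~` X) = 0%E].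

Definition moment_cone (m : nat) (h : 'I_m -> {mpoly R[n]})
    (X : set 'rV[R]_n) : set 'rV[R]_m :=
  [set \row_i \int[mu]_(x in X) (h i).@[(x : 'rV[R]_n) ord0]
    | mu in measures_on X].

End moments.

Section program.
Variables (R : realType) (n : nat).
Implicit Types (f : {mpoly R[n]}) (X : set 'rV[R]_n).

Definition variety_case (s l : nat) (p : 'I_s -> {mpoly R[n]})
    (g : 'I_l.+1 -> {mpoly R[n]}) : Prop :=
  [/\ l = 0%N,
      exists2 r : R, 0 < r & g ord0 = ball_poly n r,
      [set x : 'rV[R]_n | forall k, (p k).@[x ord0] = 0]
        `<=` [set x | 0 < (g ord0).@[x ord0]],
      real_radical (ideal_gen p)
    & groebner_basis p (ideal_gen p)].

Definition interior_case (s l : nat) (p : 'I_s -> {mpoly R[n]})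
    (g : 'I_l.+1 -> {mpoly R[n]}) X : Prop :=
  [/\ s = 1%N, forall k, p k = 0,
      exists2 r : R, 0 < r & g ord0 = ball_poly n r
    & X^° !=set0].

(* In [interior_case] the polynomial [p k = 0] has half-degree 0, so that it
   does not contribute to the maximum. *)
Definition t_min (s l m : nat) (p : 'I_s -> {mpoly R[n]})
    (g : 'I_l -> {mpoly R[n]}) (h : 'I_m -> {mpoly R[n]}) f : nat :=
  maxn (maxn (\max_j half_degree (g j)) (\max_k half_degree (p k)))
       (maxn (\max_i half_degree (h i)) (half_degree f)).

Definition feasible (t s l m : nat) (p : 'I_s -> {mpoly R[n]})
    (g : 'I_l -> {mpoly R[n]}) (h : 'I_m -> {mpoly R[n]}) f : set 'rV[R]_m :=
  [set lambda | [set u + v | u in trunc_qmodule t g & v in trunc_ideal t p]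
                  (f - \sum_i lambda ord0 i *: h i)].

Definition objective (m : nat) (b lambda : 'rV[R]_m) : R :=
  \sum_i b ord0 i * lambda ord0 i.

Definition sdp_value (t s l m : nat) (p : 'I_s -> {mpoly R[n]})
    (g : 'I_l -> {mpoly R[n]}) (h : 'I_m -> {mpoly R[n]}) f (b : 'rV[R]_m) :
    \bar R :=
  ereal_sup [set (objective b lambda)%:E | lambda in feasible t p g h f].

End program.

(* Main.v *)
(* Evaluate the polynomials of degree at most 2t at finitely many points
   a_1, ..., a_M of X that determine their restrictions to X.  A polynomial of
   degree at most 2t in the kernel vanishes on X: it is 0 in case (ii), and in
   case (i) it belongs to the real radical ideal I(p) by the real
   Nullstellensatz, hence to <p>_2t because the Groebner basis p refers to a
   graded order.  So lambda is feasible iff the vector of the values of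
   f - sum_i lambda_i h_i is a sum of squares of vectors taken in the subspaces
   {(sqrt(g_j(a_i)) q(a_i))_i | deg q <= t - t_(g_j)} of R^M, where M squares
   suffice for each j by Caratheodory's argument.  As b is in the relative
   interior of K, (1 + eM) b - e sum_i (h_k(a_i))_k is a moment vector for some
   e > 0; integrating f - sum_i lambda_i h_i against a representing measure
   bounds its values at the a_i, hence the squares, on every superlevel set of
   the objective, which is thus maximized over a compact set.

   For the real Nullstellensatz, suppose that k^(2a) + sigma is never in I.  Then
   R[x] has a prime cone that contains I and no -k^(2a).  Its trace on the
   subring generated over the rationals by x and the coefficients of p and k,
   which is countable, defines an ordered residue field.  A maximal ordered
   subfield of the algebraic closure of the latter is real closed and contains a
   point where p vanishes and k does not; quantifier elimination transfers it
   to R. *)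

Require Import Defs.
From HB Require Import structures.
From mathcomp Require Import all_boot all_order all_algebra.
From mathcomp Require Import all_classical all_reals all_analysis.
From mathcomp Require Import -(notations) mpoly.
From mathcomp Require Import generic_quotient ring_quotient fraction.
From mathcomp Require Import closed_field.
From mathcomp Require Import ring lra zify.
From mathcomp Require qe_rcf_th ordered_qelim qe_rcf.

Set Implicit Arguments.
Unset Strict Implicit.
Unset Printing Implicit Defensive.

Import Order.TTheory GRing.Theory Num.Theory.
Import numFieldTopology.Exports numFieldNormedType.Exports.

Local Open Scope classical_set_scope.
Local Open Scope ring_scope.

(** * Parametricity of the quantifier elimination of [qe_rcf] *)

Lemma nth_map_default (T1 T2 : Type) (f : T1 -> T2) x s n :
  nth (f x) (map f s) n = f (nth x s n).
Proof. by elim: s n => [|y s IHs] [|n] /=. Qed.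

(* [qe_rcf] produces formulas over any [realFieldType], but only relates them to
   quantified formulas over the same field.  Mapping the formulas produced over
   [rat] makes one and the same formula usable in all real closed fields. *)
Section MapFormula.
Variables (F F' : realFieldType) (f : {rmorphism F -> F'}).

Local Notation tF := (qe_rcf.term F).
Local Notation tF' := (qe_rcf.term F').

Fixpoint map_term (t : tF) : tF' :=
  match t with
  | qe_rcf.Var i => qe_rcf.Var _ i
  | qe_rcf.Const c => qe_rcf.Const (f c)
  | qe_rcf.NatConst n => qe_rcf.NatConst _ n
  | qe_rcf.Add u v => qe_rcf.Add (map_term u) (map_term v)
  | qe_rcf.Opp u => qe_rcf.Opp (map_term u)
  | qe_rcf.NatMul u n => qe_rcf.NatMul (map_term u) n
  | qe_rcf.Mul u v => qe_rcf.Mul (map_term u) (map_term v)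
  | qe_rcf.Exp u n => qe_rcf.Exp (map_term u) n
  end.

Fixpoint map_formula (g : qe_rcf.formula F) : qe_rcf.formula F' :=
  match g with
  | qe_rcf.Bool b => qe_rcf.Bool b
  | qe_rcf.Equal u v => qe_rcf.Equal (map_term u) (map_term v)
  | qe_rcf.Lt u v => qe_rcf.Lt (map_term u) (map_term v)
  | qe_rcf.Le u v => qe_rcf.Le (map_term u) (map_term v)
  | qe_rcf.And u v => qe_rcf.And (map_formula u) (map_formula v)
  | qe_rcf.Or u v => qe_rcf.Or (map_formula u) (map_formula v)
  | qe_rcf.Implies u v => qe_rcf.Implies (map_formula u) (map_formula v)
  | qe_rcf.Not u => qe_rcf.Not (map_formula u)
  end.

Local Notation mapP := (map map_term).

(** The elimination procedures are written in continuation-passing style. Each commutation lemma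
    therefore assumes that the two continuations correspond under the mapping, and deduces that the
    procedures do. *)
Lemma map_formula_Size p k k' : (forall n, map_formula (k n) = k' n) ->
  map_formula (qe_rcf.Size p k) = qe_rcf.Size (mapP p) k'.
Proof.
elim: p k k' => [|c p IHp] k k' kk' //=; apply: IHp => -[|n] //=.
by rewrite !kk'.
Qed.

Lemma map_formula_Isnull p k k' : (forall b, map_formula (k b) = k' b) ->
  map_formula (qe_rcf.Isnull p k) = qe_rcf.Isnull (mapP p) k'.
Proof. by move=> kk'; apply: map_formula_Size => n. Qed.

Lemma map_formula_LeadCoef p k k' :
  (forall t, map_formula (k t) = k' (map_term t)) ->
  map_formula (qe_rcf.LeadCoef p k) = qe_rcf.LeadCoef (mapP p) k'.
Proof.
elim: p k k' => [|c p IHp] k k' kk' /=; first by rewrite kk' /= rmorph0.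
by apply: IHp => t /=; rewrite !kk'.
Qed.

Lemma map_AmulXn a n : mapP (qe_rcf.AmulXn a n) = qe_rcf.AmulXn (map_term a) n.
Proof. by elim: n => //= n ->; rewrite rmorph0. Qed.

Lemma map_AddPoly p q :
  mapP (qe_rcf.AddPoly p q) = qe_rcf.AddPoly (mapP p) (mapP q).
Proof. by elim: p q => [|a p IHp] [|b q] //=; rewrite IHp. Qed.

Lemma map_ScalPoly c p :
  mapP (qe_rcf.ScalPoly c p) = qe_rcf.ScalPoly (map_term c) (mapP p).
Proof. by rewrite /qe_rcf.ScalPoly -!map_comp. Qed.

Lemma map_MulPoly p q :
  mapP (qe_rcf.MulPoly p q) = qe_rcf.MulPoly (mapP p) (mapP q).
Proof. by elim: p => //= a p IHp; rewrite map_AddPoly map_ScalPoly /= IHp. Qed.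

Lemma map_ExpPoly p n : mapP (qe_rcf.ExpPoly p n) = qe_rcf.ExpPoly (mapP p) n.
Proof.
rewrite /qe_rcf.ExpPoly; case: n => [|n] //; rewrite !iteropS.
by elim: n => //= n IHn; rewrite map_MulPoly IHn.
Qed.

Lemma map_OppPoly p : mapP (qe_rcf.OppPoly p) = qe_rcf.OppPoly (mapP p).
Proof. by rewrite /qe_rcf.OppPoly map_ScalPoly /= rmorphN1. Qed.

Lemma map_NatMulPoly n p :
  mapP (qe_rcf.NatMulPoly n p) = qe_rcf.NatMulPoly n (mapP p).
Proof. exact: map_ScalPoly. Qed.

Lemma map_Deriv p : mapP (qe_rcf.Deriv p) = qe_rcf.Deriv (mapP p).
Proof. by elim: p => //= a p IHp; rewrite map_AddPoly /= IHp. Qed.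

Definition map_opE := (map_MulPoly, map_AmulXn, map_AddPoly, map_OppPoly,
  map_NatMulPoly, map_ExpPoly, map_Deriv, map_ScalPoly).

Lemma map_formula_Rediv_rec_loop q sq cq c qq r n k k' :
  (forall c qq r, map_formula (k (c, qq, r)) = k' (c, mapP qq, mapP r)) ->
  map_formula (qe_rcf.Rediv_rec_loop q sq cq c qq r n k) =
  qe_rcf.Rediv_rec_loop (mapP q) sq (map_term cq) c (mapP qq) (mapP r) n k'.
Proof.
move=> kk'; elim: n c qq r => [|n IHn] c qq r /=;
  apply: map_formula_Size => s; case: ifP => _ //;
  apply: map_formula_LeadCoef => l; rewrite ?kk' ?IHn;
  by rewrite !map_opE /=.
Qed.

Lemma map_formula_Rediv p q k k' :
  (forall c qq r, map_formula (k (c, qq, r)) = k' (c, mapP qq, mapP r)) ->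
  map_formula (qe_rcf.Rediv p q k) = qe_rcf.Rediv (mapP p) (mapP q) k'.
Proof.
move=> kk'; apply: map_formula_Isnull => -[]; first by rewrite kk' /= rmorph0.
apply: map_formula_Size => sq; apply: map_formula_Size => sp.
apply: map_formula_LeadCoef => lq.
by rewrite (map_formula_Rediv_rec_loop _ _ _ _ _ _ _ kk') /= rmorph0.
Qed.

Lemma map_formula_Rmod p q k k' : (forall r, map_formula (k r) = k' (mapP r)) ->
  map_formula (qe_rcf.Rmod p q k) = qe_rcf.Rmod (mapP p) (mapP q) k'.
Proof. by move=> kk'; apply: map_formula_Rediv => *; apply: kk'. Qed.

Lemma map_formula_Rscal p q k k' : (forall n, map_formula (k n) = k' n) ->
  map_formula (qe_rcf.Rscal p q k) = qe_rcf.Rscal (mapP p) (mapP q) k'.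
Proof. by move=> kk'; apply: map_formula_Rediv => *; apply: kk'. Qed.

Lemma map_formula_Rgcd_loop n p q k k' :
  (forall r, map_formula (k r) = k' (mapP r)) ->
  map_formula (qe_rcf.Rgcd_loop n p q k) =
  qe_rcf.Rgcd_loop n (mapP p) (mapP q) k'.
Proof.
move=> kk'; elim: n p q => [|n IHn] p q /=; apply: map_formula_Rmod => r;
  by apply: map_formula_Isnull => -[].
Qed.

Lemma map_formula_Rgcd p q k k' :
  (forall r, map_formula (k r) = k' (mapP r)) ->
  map_formula (qe_rcf.Rgcd p q k) = qe_rcf.Rgcd (mapP p) (mapP q) k'.
Proof.
move=> kk'; rewrite /qe_rcf.Rgcd /qe_rcf.LtSize.
apply: map_formula_Size => n; apply: map_formula_Size => m.
case: ifP => _; apply: map_formula_Isnull => -[] //;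
  by apply: map_formula_Size => s; apply: map_formula_Rgcd_loop.
Qed.

Lemma map_formula_BigRgcd ps k k' :
  (forall r, map_formula (k r) = k' (mapP r)) ->
  map_formula (qe_rcf.BigRgcd ps k) = qe_rcf.BigRgcd (map mapP ps) k'.
Proof.
elim: ps k k' => [|p ps IHps] k k' kk' /=; first by rewrite kk' /= rmorph0.
by apply: IHps => r; apply: map_formula_Rgcd.
Qed.

Lemma map_formula_Changes s k k' : (forall n, map_formula (k n) = k' n) ->
  map_formula (qe_rcf.Changes s k) = qe_rcf.Changes (mapP s) k'.
Proof.
elim: s k k' => [|a s IHs] k k' kk' /=; first exact: kk'.
apply: IHs => v /=; rewrite !kk'.
by case: s.
Qed.

Lemma map_formula_SeqPInfty ps k k' :
  (forall s, map_formula (k s) = k' (mapP s)) ->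
  map_formula (qe_rcf.SeqPInfty ps k) = qe_rcf.SeqPInfty (map mapP ps) k'.
Proof.
elim: ps k k' => [|p ps IHps] k k' kk' /=; first exact: kk'.
by apply: map_formula_LeadCoef => l; apply: IHps => s; rewrite kk'.
Qed.

Lemma map_formula_SeqMInfty ps k k' :
  (forall s, map_formula (k s) = k' (mapP s)) ->
  map_formula (qe_rcf.SeqMInfty ps k) = qe_rcf.SeqMInfty (map mapP ps) k'.
Proof.
elim: ps k k' => [|p ps IHps] k k' kk' /=; first exact: kk'.
apply: map_formula_LeadCoef => l; apply: map_formula_Size => n.
by apply: IHps => s; rewrite kk' /= rmorphN1.
Qed.

Lemma map_formula_ChangesPoly ps k k' : (forall n, map_formula (k n) = k' n) ->
  map_formula (qe_rcf.ChangesPoly ps k) = qe_rcf.ChangesPoly (map mapP ps) k'.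
Proof.
move=> kk'; apply: map_formula_SeqMInfty => ms.
apply: map_formula_SeqPInfty => qs; apply: map_formula_Changes => n.
exact: map_formula_Changes.
Qed.

Lemma map_formula_NextMod p q k k' :
  (forall r, map_formula (k r) = k' (mapP r)) ->
  map_formula (qe_rcf.NextMod p q k) = qe_rcf.NextMod (mapP p) (mapP q) k'.
Proof.
move=> kk'; apply: map_formula_LeadCoef => l; apply: map_formula_Rscal => n.
by apply: map_formula_Rmod => r; rewrite kk' map_ScalPoly.
Qed.

Lemma map_formula_ModsAux p q n k k' :
  (forall s, map_formula (k s) = k' (map mapP s)) ->
  map_formula (qe_rcf.ModsAux p q n k) =
  qe_rcf.ModsAux (mapP p) (mapP q) n k'.
Proof.
elim: n p q k k' => [|n IHn] p q k k' kk' /=; first exact: kk'.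
apply: map_formula_Isnull => -[]; first exact: kk'.
by apply: map_formula_NextMod => r; apply: IHn => s; apply: kk'.
Qed.

Lemma map_formula_TaqR p q k k' : (forall n, map_formula (k n) = k' n) ->
  map_formula (qe_rcf.TaqR p q k) = qe_rcf.TaqR (mapP p) (mapP q) k'.
Proof.
move=> kk'; rewrite /qe_rcf.TaqR /qe_rcf.Mods -map_Deriv -map_MulPoly.
apply: map_formula_Size => n; apply: map_formula_Size => m.
apply: map_formula_ModsAux => s; exact: map_formula_ChangesPoly.
Qed.

Lemma map_PolyComb sq sc :
  mapP (qe_rcf.PolyComb sq sc) = qe_rcf.PolyComb (map mapP sq) sc.
Proof.
rewrite /qe_rcf.PolyComb size_map; elim: (iota _ _) => //= i s IHs.
by rewrite map_MulPoly IHs map_ExpPoly -(nth_map_default mapP).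
Qed.

Lemma map_Pcq sq i : mapP (qe_rcf.Pcq sq i) = qe_rcf.Pcq (map mapP sq) i.
Proof.
rewrite /qe_rcf.Pcq size_map -(nth_map_default mapP) -map_comp.
by congr nth; apply: eq_map => s /=; rewrite map_PolyComb.
Qed.

Lemma map_formula_TaqsR p sq i k k' :
  (forall t, map_formula (k t) = k' (map_term t)) ->
  map_formula (qe_rcf.TaqsR p sq i k) =
  qe_rcf.TaqsR (mapP p) (map mapP sq) i k'.
Proof.
move=> kk'; rewrite /qe_rcf.TaqsR -map_Pcq.
by apply: map_formula_TaqR => n; rewrite kk' /= rmorph_int.
Qed.

Lemma map_BoundingPoly sq :
  mapP (qe_rcf.BoundingPoly sq) = qe_rcf.BoundingPoly (map mapP sq).
Proof.
rewrite /qe_rcf.BoundingPoly map_Deriv; congr qe_rcf.Deriv.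
by elim: sq => //= q sq IHsq; rewrite map_MulPoly IHsq.
Qed.

(** The coefficients are entries of the inverse of an integer matrix, and a field morphism fixes
    integers and commutes with matrix inversion. *)
Lemma map_coefs n i : f (qe_rcf_th.coefs F n i) = qe_rcf_th.coefs F' n i.
Proof.
rewrite /qe_rcf_th.coefs -(nth_map_default f) rmorph0 -map_comp; congr nth.
apply: eq_map => j /=.
have map_intr (M : 'M[int]_(3 ^ n)) :
    map_mx f (map_mx intr M) = map_mx intr M.
  by apply/matrixP => u v; rewrite !mxE rmorph_int.
rewrite !castmxE -map_intr -map_invmx [RHS]mxE.
by [].
Qed.

Lemma map_Coefs n i : map_term (qe_rcf.Coefs F n i) = qe_rcf.Coefs F' n i.
Proof.
rewrite /qe_rcf.Coefs /=; case: n => [|[|n]]; rewrite ?map_coefs ?rmorph_nat //.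
by case: i => [|[|[|i]]] /=; rewrite ?fmorphV ?rmorph_nat ?nth_nil ?rmorph0.
Qed.

Lemma map_formula_CcountWeak p sq k k' :
  (forall t, map_formula (k t) = k' (map_term t)) ->
  map_formula (qe_rcf.CcountWeak p sq k) =
  qe_rcf.CcountWeak (mapP p) (map mapP sq) k'.
Proof.
move=> kk'; rewrite /qe_rcf.CcountWeak size_map.
rewrite -[qe_rcf.NatConst F' 0]/(map_term (qe_rcf.NatConst F 0)).
move: (qe_rcf.NatConst F 0) => t.
elim: (3 ^ _)%N t => [|n IHn] t //=.
apply: map_formula_TaqsR => u; rewrite -map_Coefs; exact: IHn.
Qed.

(** This formula decides whether the polynomials of [sp] have a common root at which those of [sq]
    are all positive; mapping it is what the preceding lemmas prepare. *)
Lemma map_formula_CcountGt0 sp sq :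
  map_formula (qe_rcf.CcountGt0 sp sq) =
  qe_rcf.CcountGt0 (map mapP sp) (map mapP sq).
Proof.
apply: map_formula_BigRgcd => p; apply: map_formula_Isnull => -[] /=; last first.
  exact: map_formula_CcountWeak.
rewrite -map_BoundingPoly.
apply: map_formula_CcountWeak => c /=; congr (qe_rcf.Or _ (qe_rcf.Or _ _)).
  elim: sq => //= q sq IHsq; rewrite IHsq; congr qe_rcf.And.
  exact: map_formula_LeadCoef.
elim: sq => //= q sq IHsq; rewrite IHsq; congr qe_rcf.And.
by apply: map_formula_Size => n; apply: map_formula_LeadCoef.
Qed.

Lemma map_abstrX i t : mapP (qe_rcf.abstrX i t) = qe_rcf.abstrX i (map_term t).
Proof.
elim: t => //=.
- by move=> n; case: eqP.
- by move=> t IHt u IHu; rewrite map_AddPoly IHt IHu.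
- by move=> t IHt; rewrite map_OppPoly IHt.
- by move=> t IHt n; rewrite map_NatMulPoly IHt.
- by move=> t IHt u IHu; rewrite map_MulPoly IHt IHu.
- by move=> t IHt n; rewrite map_ExpPoly IHt.
Qed.

End MapFormula.

(** * Transfer of sign conditions between real closed fields *)

Section OneVariableElimination.

Local Notation term := (qe_rcf.term rat).

Definition eval_rat (F : rcfType) (e : seq F) (t : term) : F :=
  qe_rcf.eval e (map_term (@ratr F : {rmorphism rat -> F}) t).

(** The truth value of a formula depends only on the signs of these terms: any comparison of [u]
    with [v] can be read off the sign of [u - v]. *)
Fixpoint atoms (g : qe_rcf.formula rat) : seq term :=
  match g with
  | qe_rcf.Bool b => [::]
  | qe_rcf.Equal u v | qe_rcf.Lt u v | qe_rcf.Le u v =>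
      [:: qe_rcf.Add u (qe_rcf.Opp v)]
  | qe_rcf.And g1 g2 | qe_rcf.Or g1 g2 | qe_rcf.Implies g1 g2 =>
      atoms g1 ++ atoms g2
  | qe_rcf.Not g1 => atoms g1
  end.

Definition same_signs (F1 F2 : rcfType) (e1 : seq F1) (e2 : seq F2)
    (ts : seq term) : bool :=
  all (fun t => sgz (eval_rat e1 t) == sgz (eval_rat e2 t)) ts.

Lemma cmp_sgzB (F1 F2 : realDomainType) (a b : F1) (c d : F2) :
  sgz (a - b) = sgz (c - d) ->
  [/\ (a == b) = (c == d), (a < b) = (c < d) & (a <= b) = (c <= d)].
Proof.
move=> sgz_eq; have := (sgz_eq0 (a - b), sgz_lt0 (a - b), sgz_le0 (a - b)).
by rewrite sgz_eq sgz_eq0 sgz_lt0 sgz_le0 !subr_eq0 !subr_lt0 !subr_le0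
  => -[[-> ->] ->].
Qed.

Lemma qf_eval_same_signs (F1 F2 : rcfType) (e1 : seq F1) (e2 : seq F2) g :
  same_signs e1 e2 (atoms g) ->
  qe_rcf.qf_eval e1 (map_formula (@ratr F1 : {rmorphism rat -> F1}) g) =
  qe_rcf.qf_eval e2 (map_formula (@ratr F2 : {rmorphism rat -> F2}) g).
Proof.
rewrite /same_signs; elim: g => //=.
- by move=> u v; rewrite andbT => /eqP /cmp_sgzB[].
- by move=> u v; rewrite andbT => /eqP /cmp_sgzB[].
- by move=> u v; rewrite andbT => /eqP /cmp_sgzB[].
- by move=> g1 IH1 g2 IH2; rewrite all_cat => /andP[/IH1 -> /IH2 ->].
- by move=> g1 IH1 g2 IH2; rewrite all_cat => /andP[/IH1 -> /IH2 ->].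
- by move=> g1 IH1 g2 IH2; rewrite all_cat => /andP[/IH1 -> /IH2 ->].
- by move=> g1 IH1 /IH1 ->.
Qed.

Fixpoint sign_words n : seq (seq int) :=
  if n is n'.+1 then [seq s :: w | s <- [:: 0; 1; -1], w <- sign_words n']
  else [:: [::]].

Lemma sign_words_sgz (F : rcfType) (xs : seq F) :
  [seq sgz x | x <- xs] \in sign_words (size xs).
Proof.
elim: xs => [|x xs IHxs]; first by rewrite mem_head.
apply/allpairsP; exists (sgz x, [seq sgz y | y <- xs]); split=> //.
by rewrite !inE; case: sgzP.
Qed.

(** Prescribing the signs [w] of the terms [ts], seen as polynomials in the variable [i], amounts to
    the equations [zero_polys] and the strict inequalities [pos_polys], where a term of negative
    sign is replaced with its opposite. *)
Definition zero_polys i (ts : seq term) (w : seq int) :=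
  [seq qe_rcf.abstrX i tw.1 | tw <- zip ts w & tw.2 == 0].

Definition pos_polys i (ts : seq term) (w : seq int) :=
  [seq qe_rcf.abstrX i (if tw.2 == 1 then tw.1 else qe_rcf.Opp tw.1)
  | tw <- zip ts w & tw.2 != 0].

Lemma realizable_signs (F : rcfType) (e : seq F) i ts w :
  w \in sign_words (size ts) ->
  reflect (exists x, [seq sgz (eval_rat (set_nth 0 e i x) t) | t <- ts] = w)
    (qe_rcf.qf_eval e (map_formula (@ratr F : {rmorphism rat -> F})
       (qe_rcf.CcountGt0 (zero_polys i ts w) (pos_polys i ts w)))).
Proof.
move=> wP; rewrite map_formula_CcountGt0 qe_rcf.eval_CcountGt0.
apply: (equivP (qe_rcf_th.ccount_gt0P _ _)).
suff H x : (\big[andb/true]_(p <- map (qe_rcf.eval_poly e) (map (map (map_term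
      (@ratr F : {rmorphism rat -> F}))) (zero_polys i ts w))) (p.[x] == 0)) &&
    (\big[andb/true]_(q <- map (qe_rcf.eval_poly e) (map (map (map_term
      (@ratr F : {rmorphism rat -> F}))) (pos_polys i ts w))) (0 < q.[x])) =
    ([seq sgz (eval_rat (set_nth 0 e i x) t) | t <- ts] == w).
  by split=> -[x]; [rewrite H => /eqP | move=> /eqP; rewrite -H]; exists x.
rewrite !big_all; elim: ts w wP => [|t ts IHts] w.
  by rewrite inE => /eqP ->.
move=> /allpairsP[[s v]] /= [+ vP ->]; rewrite eqseq_cons -(IHts v vP).
have ev u : (qe_rcf.eval_poly e [seq map_term (@ratr F : {rmorphism rat -> F}) i
      | i <- qe_rcf.abstrX i u]).[x] = eval_rat (set_nth 0 e i x) u.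
  by rewrite map_abstrX qe_rcf.abstrXP.
rewrite /zero_polys /pos_polys !inE => /or3P[]/eqP -> /=.
- by rewrite ev sgz_eq0 andbA.
- by rewrite ev sgz_cp0 andbCA.
- rewrite (ev (qe_rcf.Opp t)) [X in 0 < X](_ : _ = - eval_rat (set_nth 0 e i x) t) //.
  by rewrite sgz_cp0 oppr_gt0 andbCA.
Qed.

(** There are finitely many sign vectors, and for each of them a quantifier-free rational formula
    decides whether some value of the variable [i] realizes it. The atoms of all these formulas form
    [us]. *)
Theorem sign_elimination (ts : seq term) i :
  exists us : seq term, forall (F1 F2 : rcfType) (e1 : seq F1) (e2 : seq F2),
    same_signs e1 e2 us ->
    forall x1, exists x2, same_signs (set_nth 0 e1 i x1) (set_nth 0 e2 i x2) ts.
Proof.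
exists (flatten [seq atoms (qe_rcf.CcountGt0 (zero_polys i ts w)
  (pos_polys i ts w)) | w <- sign_words (size ts)]) => F1 F2 e1 e2.
rewrite /same_signs; set same := fun t => _.
have all_flat ss : all same (flatten ss) = all (all same) ss.
  by elim: ss => //= s ss IHss; rewrite all_cat IHss.
rewrite all_flat all_map => /allP e12 x1.
(* The sign vector realized by [x1] over [F1] is realizable over [F2] too, because the formula that
   decides this has the same truth value on both sides. *)
have wP := sign_words_sgz [seq eval_rat (set_nth 0 e1 i x1) t | t <- ts].
rewrite size_map -map_comp in wP.
have /(realizable_signs e1 i)/introT := wP.
move=> /(_ (ex_intro _ x1 erefl)); rewrite (qf_eval_same_signs (e12 _ wP)).
case/(realizable_signs e2 i wP) => x2 e2x2; exists x2.
rewrite -(all_map (fun t => (sgz (eval_rat (set_nth 0 e1 i x1) t),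
  sgz (eval_rat (set_nth 0 e2 i x2) t))) (fun p => p.1 == p.2)).
elim: ts e2x2 {wP e12} => //= t ts IHts [-> /IHts ->].
by rewrite eqxx.
Qed.

(** The last variable is eliminated first, and the terms obtained are handed to the induction
    hypothesis. In this form the elimination transfers a whole point from one real closed field to
    another with common parameters. *)
Corollary sign_elimination_seq (ts : seq term) k n :
  exists us : seq term, forall (F1 F2 : rcfType) (e1 : seq F1) (e2 : seq F2),
    size e1 = k -> size e2 = k -> same_signs e1 e2 us ->
    forall x1, size x1 = n ->
    exists2 x2, size x2 = n & same_signs (e1 ++ x1) (e2 ++ x2) ts.
Proof.
elim: n ts => [|n IHn] ts.
  exists ts => F1 F2 e1 e2 _ _ e12 [|//] _; exists [::] => //.
  by rewrite !cats0.
have [us usP] := sign_elimination ts (k + n).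
have [vs vsP] := IHn us; exists vs => F1 F2 e1 e2 s1 s2 e12 x1.
elim/last_ind: x1 => // x1 a _; rewrite size_rcons => -[sx1].
have [x2 sx2 x12] := vsP _ _ _ _ s1 s2 e12 x1 sx1.
have [b] := usP _ _ _ _ x12 a.
have set_last (F : rcfType) (e x : seq F) c : size e = k -> size x = n ->
    set_nth 0 (e ++ x) (k + n) c = e ++ rcons x c.
  by move=> <- <-; rewrite -size_cat -cats1 set_nthE ltnn subnn catA.
rewrite !set_last // => H; exists (rcons x2 b); first by rewrite size_rcons sx2.
exact: H.
Qed.

End OneVariableElimination.

(** * Prime cones *)

(** Zorn's lemma is applied to the sets whose union with [T] satisfies [Pr], so that the empty chain
    is covered by [Pr T]. *)
Lemma Zorn_above (U : Type) (T : set U) (Pr : set (set U)) : Pr T ->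
    (forall F : set (set U), F !=set0 -> F `<=` Pr -> total_on F subset ->
      Pr (\bigcup_(X in F) X)) ->
  exists M, [/\ Pr M, T `<=` M & forall B, M `<=` B -> Pr B -> B = M].
Proof.
move=> PrT Prcup; have [|M [PrM Mmax]] := @Zorn_bigcup U [set X | Pr (T `|` X)].
  move=> F FPr Ftot /=; have [->|F0] := eqVneq F set0.
    by rewrite bigcup_set0 setU0.
  rewrite (_ : T `|` _ = \bigcup_(Y in [set T `|` X | X in F]) Y).
    apply: Prcup => [|_ [X /FPr ? <-] //|_ _ [X FX <-] [Y FY <-]].
      by have /set0P[X FX] := F0; exists (T `|` X); exists X.
    by have [XY|YX] := Ftot X Y FX FY; [left|right]; apply: setUS.
  rewrite eqEsubset; split=> x.
    have /set0P[Y FY] := F0.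
    case=> [Tx|[X FX Xx]]; last by exists (T `|` X); [exists X | right].
    by exists (T `|` Y); [exists Y | left].
  by case=> _ [X FX <-] [Tx|Xx]; [left | right; exists X].
exists (T `|` M); split=> [//|x|B MB PrB]; first by left.
have TMB : T `|` B = B by apply/setUidPr/(subset_trans _ MB)/subsetUl.
apply/seteqP; split=> //; apply: contrapT => nBM.
apply: (Mmax B); last by rewrite /= TMB.
split; first by apply: subset_trans MB; apply: subsetUr.
by move=> BM; apply: nBM => x /BM; right.
Qed.

Section PrimeCone.
Variable A : comPzRingType.
Implicit Types (T P : set A) (x y : A).

Definition preordering T := [/\ forall x y, T x -> T y -> T (x + y),
  forall x y, T x -> T y -> T (x * y) & forall x, T (x ^+ 2)].

Lemma preordering_adjoin T x : preordering T ->
  preordering [set y | exists u v, [/\ T u, T v & y = u + x * v]].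
Proof.
move=> [TD TM T2]; have T0 : T 0 by have := T2 0; rewrite expr0n.
split=> [_ _ [u [v [Tu Tv ->]]] [u' [v' [Tu' Tv' ->]]]|
  _ _ [u [v [Tu Tv ->]]] [u' [v' [Tu' Tv' ->]]]|y].
- by exists (u + u'), (v + v'); split; [exact: TD|exact: TD|ring].
- exists (u * u' + x ^+ 2 * (v * v')), (u * v' + v * u'); split; last by ring.
    by apply: (TD _ _); apply: (TM _ _) => //; exact: TM.
  by apply: (TD _ _); exact: TM.
- by exists (y ^+ 2), 0; split=> //; rewrite mulr0 addr0.
Qed.

(** The last condition is primality of the support, the set of the [x] such that [x] and [- x] are
    in [P]. Properness is stated apart, through elements [- e ^+ (2 * a)] that [P] must avoid;
    [a = 0] excludes [-1]. *)
Definition prime_cone P := [/\ preordering P, forall x, P x \/ P (- x) &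
  forall x y, P (x * y) -> P (- (x * y)) ->
    (P x /\ P (- x)) \/ (P y /\ P (- y))].

(** A preordering that is maximal among those avoiding all [- e ^+ (2 * a)] is a prime cone:
    adjoining an element outside it produces one of these, and two such representations multiply to
    one inside the preordering itself. *)
Lemma prime_cone_extension T e : preordering T ->
    (forall a, ~ T (- e ^+ (2 * a))) ->
  exists P, [/\ prime_cone P, T `<=` P & forall a, ~ P (- e ^+ (2 * a))].
Proof.
move=> preT Te.
pose Pr := [set P | preordering P /\ forall a, ~ P (- e ^+ (2 * a))].
have [|F [X0 FX0] FPr Ftot|P [[preP Pe] TP Pmax]] := @Zorn_above A T Pr.
- by [].
- split=> [|a [X FX]]; last by have [_ ] := FPr X FX; apply.
  have F2 x y : (\bigcup_(X in F) X) x -> (\bigcup_(X in F) X) y ->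
      exists X, [/\ F X, X x & X y].
    move=> [X FX Xx] [Y FY Yy]; have [XY|YX] := Ftot X Y FX FY.
      by exists Y; split=> //; exact: XY.
    by exists X; split=> //; exact: YX.
  split=> [x y Fx /(F2 _ _ Fx)[X [FX Xx Xy]]|x y Fx /(F2 _ _ Fx)[X [FX Xx Xy]]|x].
  + by exists X => //; have [[XD _ _] _] := FPr X FX; exact: XD.
  + by exists X => //; have [[_ XM _] _] := FPr X FX; exact: XM.
  + by exists X0 => //; have [[_ _ ]] := FPr X0 FX0.
have [PD PM P2] := preP.
have P0 : P 0 by have := P2 0; rewrite expr0n.
have adjoin x : ~ P x ->
    exists u v a, [/\ P u, P v & - e ^+ (2 * a) = u + x * v].
  move=> nPx; apply: contrapT => H; apply: nPx.
  rewrite -(Pmax _ _ (conj (preordering_adjoin x preP) _)).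
  - by exists 0, 1; split=> //; [have := P2 1; rewrite expr1n|rewrite mulr1 add0r].
  - by move=> y Py; exists y, 0; split=> //; rewrite mulr0 addr0.
  - by move=> a [u [v [Pu Pv E]]]; apply: H; exists u, v, a.
have e2 a : P (e ^+ (2 * a)) by rewrite mulnC exprM; exact: P2.
exists P; split=> //; split=> // [x|x y].
  apply: contrapT => /not_orP[/adjoin[u [v [a [Pu Pv ea]]]]].
  move=> /adjoin[u' [v' [a' [Pu' Pv' ea']]]].
  apply: (Pe (a + a')%N).
  (* Multiply [e ^+ (2 * a) + u = - x * v] by [e ^+ (2 * a') + u' = x * v']. *)
  have -> : - e ^+ (2 * (a + a')) =
      e ^+ (2 * a) * u' + u * e ^+ (2 * a') + u * u' + x ^+ 2 * (v * v').
    rewrite mulnDr exprD.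
    have -> : e ^+ (2 * a) = - u - x * v by rewrite -[LHS]opprK ea; ring.
    have -> : e ^+ (2 * a') = - u' + x * v' by rewrite -[LHS]opprK ea'; ring.
    by ring.
  by repeat first
    [assumption | exact: P2 | exact: e2 | apply: (PD _ _) | apply: (PM _ _)].
move=> Pxy PNxy; apply: contrapT => /not_orP[nx ny].
(* Signs are chosen so that [- z] and [- w] are outside [P] and can be adjoined; the product [z * w]
   is still in the support. The two representations are then multiplied as before. *)
have [z [Pz nPNz]] : exists z, [/\ (z = x \/ z = - x) & ~ P (- z)].
  have [Px|Px] := pselect (P x); last by exists (- x); split; [right|rewrite opprK].
  by exists x; split; [left | move=> PNx; apply: nx].
have [w [Pw nPNw]] : exists w, [/\ (w = y \/ w = - y) & ~ P (- w)].
  have [Py|Py] := pselect (P y); last by exists (- y); split; [right|rewrite opprK].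
  by exists y; split; [left | move=> PNy; apply: ny].
have [Pzw PNzw] : P (z * w) /\ P (- (z * w)).
  by case: Pz Pw => [->|->] [->|->]; rewrite ?mulrN ?mulNr ?opprK.
have [u [v [a [Pu Pv ea]]]] := adjoin _ nPNz.
have [u' [v' [a' [Pu' Pv' ea']]]] := adjoin _ nPNw.
apply: (Pe (a + a')%N).
have -> : - e ^+ (2 * (a + a')) =
    e ^+ (2 * a) * u' + u * e ^+ (2 * a') + u * u' + (- (z * w)) * (v * v').
  rewrite mulnDr exprD.
  have -> : e ^+ (2 * a) = - u + z * v by rewrite -[LHS]opprK ea; ring.
  have -> : e ^+ (2 * a') = - u' + w * v' by rewrite -[LHS]opprK ea'; ring.
  by ring.
by repeat first
  [assumption | exact: P2 | exact: e2 | apply: (PD _ _) | apply: (PM _ _)].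
Qed.

End PrimeCone.

(** * Real closed extensions of ordered fields *)

Section OrderedSubfield.
Variable E : fieldType.
Implicit Types (Q : set E) (x y : E).

Definition pm Q : set E := [set x | Q x \/ Q (- x)].

(** [Q] is the set of nonnegative elements of an ordered field with underlying set [pm Q]. As field
    and order are both encoded in [Q], extension of ordered fields becomes inclusion of sets, ready
    for Zorn's lemma. *)
Record ordered_subfield Q : Prop := OrderedSubfield {
  osub_add : forall x y, Q x -> Q y -> Q (x + y);
  osub_mul : forall x y, Q x -> Q y -> Q (x * y);
  osub_one : Q 1;
  osub_N1 : ~ Q (-1);
  osub_pmB : forall x y, pm Q x -> pm Q y -> pm Q (x - y);
  osub_pmV : forall x, pm Q x -> pm Q x^-1 }.

Lemma pmM Q x y : ordered_subfield Q -> pm Q x -> pm Q y -> pm Q (x * y).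
Proof.
move=> [_ QM _ _ _ _] [Qx|Qx] [Qy|Qy].
- by left; apply: QM.
- by right; rewrite -mulrN; apply: QM.
- by right; rewrite -mulNr; apply: QM.
- by left; rewrite -mulrNN; apply: QM.
Qed.

Lemma osub_anti Q x : ordered_subfield Q -> Q x -> Q (- x) -> x = 0.
Proof.
move=> Qo Qx QNx; apply: contrapT => /eqP x0.
have [Qv|Qv] : pm Q x^-1 by apply: osub_pmV => //; left.
  by apply: (osub_N1 Qo); rewrite -(mulfV x0) -mulNr; apply: osub_mul.
by apply: (osub_N1 Qo); rewrite -(mulfV x0) -mulrN; apply: osub_mul.
Qed.

Section Structure.
Variable S : {Q : set E | ordered_subfield Q}.
Let Q : set E := sval S.
Let Qo : ordered_subfield Q := svalP S.

(** The axioms are packed in [S], so that the type [osub S] alone determines its field and order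
    structures. *)
Definition osub_pred : pred E := fun x => `[< pm (sval S) x >].

Record osub := OSub { osub_val :> E; osub_valP : osub_pred osub_val }.

HB.instance Definition _ := [isSub of osub for osub_val].
HB.instance Definition _ := [Choice of osub by <:].

Lemma osub_divring_closed : divring_closed osub_pred.
Proof.
split=> [|x y|x y]; rewrite !unfold_in /osub_pred.
- by apply/asboolP; left; apply: osub_one.
- by move=> /asboolP Qx /asboolP Qy; apply/asboolP; apply: osub_pmB.
- move=> /asboolP Qx /asboolP Qy; apply/asboolP; apply: pmM => //.
  exact: osub_pmV.
Qed.

HB.instance Definition _ := GRing.isDivringClosed.Build E osub_pred
  osub_divring_closed.
HB.instance Definition _ := [SubChoice_isSubIntegralDomain of osub by <:].
HB.instance Definition _ := [SubIntegralDomain_isSubField of osub by <:].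

Implicit Types u v : osub.

Definition osub_le u v := `[< sval S (val v - val u) >].
Definition osub_norm u := if osub_le 0 u then u else - u.

Lemma osub_le0_add u v : osub_le 0 u -> osub_le 0 v -> osub_le 0 (u + v).
Proof.
rewrite /osub_le !subr0 => /asboolP Qx /asboolP Qy; apply/asboolP.
exact: osub_add.
Qed.

Lemma osub_le0_mul u v : osub_le 0 u -> osub_le 0 v -> osub_le 0 (u * v).
Proof.
rewrite /osub_le !subr0 => /asboolP Qx /asboolP Qy; apply/asboolP.
exact: osub_mul.
Qed.

Lemma osub_le0_anti u : osub_le 0 u -> osub_le u 0 -> u = 0.
Proof.
rewrite /osub_le subr0 sub0r => /asboolP Qx /asboolP Qy; apply/val_inj.
exact: osub_anti Qx Qy.
Qed.

Lemma osub_sub_ge0 u v : osub_le 0 (v - u) = osub_le u v.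
Proof. by rewrite /osub_le subr0. Qed.

Lemma osub_le0_total u : osub_le 0 u || osub_le u 0.
Proof.
rewrite /osub_le subr0 sub0r; have /asboolP[Qx|Qx] := valP u.
  by apply/orP; left; apply/asboolP.
by apply/orP; right; apply/asboolP.
Qed.

Lemma osub_normN u : osub_norm (- u) = osub_norm u.
Proof.
rewrite /osub_norm opprK; case: ifPn => [Nx|Nx]; case: ifPn => [px|px] //.
  have -> : u = 0; last by rewrite oppr0.
  by apply: osub_le0_anti => //; move: Nx; rewrite /osub_le subr0 sub0r.
move: (osub_le0_total u); rewrite (negbTE px) => x0; move: Nx.
by rewrite /osub_le subr0; move: x0; rewrite /osub_le sub0r /= => ->.
Qed.

Lemma osub_ge0_norm u : osub_le 0 u -> osub_norm u = u.
Proof. by rewrite /osub_norm => ->. Qed.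

HB.instance Definition _ := Num.IntegralDomain_isLeReal.Build osub
  osub_le0_add osub_le0_mul osub_le0_anti osub_sub_ge0 osub_le0_total
  osub_normN osub_ge0_norm (fun _ _ => erefl).

Lemma osub_ge0P u : reflect (sval S (val u)) (0 <= u).
Proof.
rewrite (_ : (0 <= u) = `[< sval S (val u - val (0 : osub)) >]) // subr0.
exact: asboolP.
Qed.

End Structure.
End OrderedSubfield.

(** * Weighted sums of squares of polynomials in one variable *)

Section WeightedSums.
Variable F : realFieldType.
Implicit Types (g s p : {poly F}) (c x : F).

(** Nonnegative elements of [F] need not be squares, whence the weights. *)
Inductive weighted_sos : {poly F} -> Prop :=
| Wsos0 : weighted_sos 0
| WsosD c g s : 0 <= c -> weighted_sos s -> weighted_sos (c *: g ^+ 2 + s).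

Lemma wsos_sq c g : 0 <= c -> weighted_sos (c *: g ^+ 2).
Proof. by move=> c0; rewrite -[_ *: _]addr0; apply: WsosD => //; constructor. Qed.

Lemma wsos_add s s' : weighted_sos s -> weighted_sos s' -> weighted_sos (s + s').
Proof.
by move=> Ws Ws'; elim: Ws => [|c g s0 c0 _ IH]; rewrite ?add0r // -addrA;
  apply: WsosD.
Qed.

Lemma wsos_mul s s' : weighted_sos s -> weighted_sos s' -> weighted_sos (s * s').
Proof.
move=> Ws Ws'; elim: Ws => [|c g s0 c0 _ IH]; first by rewrite mul0r; constructor.
rewrite mulrDl; apply: wsos_add => //.
elim: Ws' => [|c' g' s1 c'0 _ IH']; first by rewrite mulr0; constructor.
rewrite mulrDr -scalerAl -scalerAr scalerA -exprMn.
apply: wsos_add; last by [].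
by apply: wsos_sq; apply: mulr_ge0.
Qed.

(** Each square is reduced by replacing [g] with its remainder modulo [p]. The result is again a
    weighted sum of squares, hence nonnegative everywhere, and its degree is at most twice the
    degree of [p] minus 2. *)
Lemma wsos_mod s p : (1 < size p)%N -> weighted_sos s ->
  exists r k, [/\ s = r + p * k, (size r <= 2 * (size p).-1 - 1)%N
    & forall x, 0 <= r.[x]].
Proof.
move=> p1; have p0 : p != 0 by rewrite -size_poly_gt0 (ltn_trans _ p1).
elim=> [|c g s0 c0 _ [r [k [-> sr r0]]]].
  by exists 0, 0; rewrite mulr0 addr0 size_poly0; split=> // x; rewrite horner0.
set m := g %% p; exists (c *: m ^+ 2 + r).
exists (k + c *: ((m * (g %/ p)) *+ 2 + (g %/ p) ^+ 2 * p)).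
split=> [||x].
- rewrite {1}(divp_eq g p) -/m -!mul_polyC; move: (g %/ p) => d.
  by ring.
- rewrite (leq_trans (size_polyD _ _)) // geq_max sr andbT.
  rewrite (leq_trans (size_scale_leq _ _)) // expr2.
  rewrite (leq_trans (size_polyMleq _ _)) //.
  have : (size m < size p)%N by rewrite ltn_modp.
  by move: p1; move: (size m) (size p) => u v; lia.
- by rewrite hornerD hornerZ horner_exp addr_ge0 // mulr_ge0 // sqr_ge0.
Qed.

End WeightedSums.

(** * Extending an ordering to a root of an irreducible polynomial that changes sign *)

Section AdjoinRoot.
Variables (F : realFieldType) (E : fieldType) (f : {rmorphism F -> E}).
Variables (p : {poly F}) (a b : F) (theta : E).
Hypotheses (p_irr : irreducible_poly p) (pa : p.[a] < 0) (pb : 0 < p.[b]).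
Hypothesis ivt : forall q : {poly F}, (size q < size p)%N ->
  q.[a] <= 0 <= q.[b] -> exists x, root q x.
Hypothesis ptheta : root (map_poly f p) theta.

Let phi (g : {poly F}) : E := (map_poly f g).[theta].

(** The preimage in F[X] of the weighted sums of squares of F[X]/(p), a field isomorphic to
    F(theta). *)
Let T := [set g | exists2 s, weighted_sos s & exists k, g = s + p * k].

Let T_preordering : preordering T.
Proof.
split=> [_ _ [s Ws [k ->]] [s' Ws' [k' ->]]|_ _ [s Ws [k ->]] [s' Ws' [k' ->]]|g].
- by exists (s + s'); [exact: wsos_add | exists (k + k'); ring].
- exists (s * s'); first exact: wsos_mul.
  by exists (s * k' + k * s' + p * k * k'); ring.
- exists (g ^+ 2); first by rewrite -[_ ^+ 2]scale1r; apply: wsos_sq.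
  by exists 0; rewrite mulr0 addr0.
Qed.

(* If [-1] were in [T], then [1 + r = p * H] for some [r >= 0] of degree less
   than [2 * deg p], so that [H] changes sign between [a] and [b] as [p] does;
   but then [H], which has a smaller degree than [p], has a root. *)
Let T_N1 : ~ T (-1).
Proof.
have [p1 _] := p_irr; have p0 := irredp_neq0 p_irr.
case=> s Ws [k E1]; have [r [h [sE sr r0]]] := wsos_mod p1 Ws.
have E2 : 1 + r = p * (- (h + k)).
  rewrite (_ : 1 + r = r - -1); last by ring.
  by rewrite E1 sE; ring.
move: (- (h + k)) E2 => H E2.
have r1 x : 0 < (1 + r).[x] by rewrite hornerD hornerC ltr_wpDr.
have H0 : H != 0.
  by apply/eqP => H0; have := r1 0; rewrite E2 H0 mulr0 horner0 ltxx.
have sH : (size H < size p)%N.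
  have : (size (1 + r)%R <= maxn 1 (2 * (size p).-1 - 1))%N.
    by rewrite (leq_trans (size_polyD _ _)) // geq_max !leq_max size_poly1 /= sr orbT.
  by rewrite E2 size_mul //; move: p1; move: (size p) (size H) => [|[|n]] //= m _; lia.
have Ha : H.[a] <= 0.
  by have := r1 a; rewrite E2 hornerM nmulr_rgt0 // => /ltW.
have Hb : 0 <= H.[b].
  by have := r1 b; rewrite E2 hornerM pmulr_rgt0 // => /ltW.
have [|x /rootP Hx] := ivt sH; first by rewrite Ha Hb.
by have := r1 x; rewrite E2 hornerM Hx mulr0 ltxx.
Qed.

Let phi_dvdp g : phi g = 0 -> p %| g.
Proof.
move=> g0; have [_ p_irr2] := p_irr.
have [/Bezout_coprimepP[[u v] /= /eqpf_eq[c c0 uv]]|cop] := boolP (coprimep p g).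
  have : phi (u * p + v * g) = 0.
    rewrite /phi rmorphD !rmorphM hornerD !hornerM (rootP ptheta).
    by move: g0; rewrite /phi => ->; rewrite !mulr0 addr0.
  rewrite uv /phi alg_polyC map_polyC hornerC => /eqP.
  by rewrite fmorph_eq0 (negbTE c0).
have := p_irr2 (gcdp p g) cop (dvdp_gcdl _ _).
by move=> /eqp_dvdl <-; apply: dvdp_gcdr.
Qed.

(** The preordering [T] avoids [-1], hence lies in a prime cone avoiding it. Evaluation at [theta]
    maps this cone onto the nonnegative elements of an ordering of F(theta) that extends the one of
    [F]. *)
Lemma adjoin_root : exists Q : set E, [/\ ordered_subfield Q,
  forall c, 0 <= c -> Q (f c) & pm Q theta].
Proof.
have [|P [[preP tot _] TP PN1]] := prime_cone_extension (e := 1) T_preordering.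
  by move=> n; rewrite expr1n.
have {}PN1 : ~ P (-1) by move=> ?; apply: (PN1 0%N).
have [PD PM P2] := preP.
have P1 : P 1 by rewrite -[1](expr1n _ 2).
pose Q := [set phi g | g in P].
have phiB g h : phi (g - h) = phi g - phi h by rewrite /phi rmorphB hornerD hornerN.
have phiM g h : phi (g * h) = phi g * phi h by rewrite /phi rmorphM hornerM.
have phiN g : phi (- g) = - phi g by rewrite /phi rmorphN hornerN.
have phiC c : phi c%:P = f c by rewrite /phi map_polyC hornerC.
have pmP x : pm Q x <-> exists g, phi g = x.
  split=> [[[g _ <-]|[g _ gx]]|[g <-]].
  - by exists g.
  - by exists (- g); rewrite phiN gx opprK.
  - by have [Pg|Pg] := tot g; [left; exists g | right; exists (- g)].
exists Q; split.
- split=> [_ _ [g Pg <-] [h Ph <-]|_ _ [g Pg <-] [h Ph <-]|||x y|x].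
  + by exists (g + h); [exact: PD | rewrite /phi rmorphD hornerD].
  + by exists (g * h); [exact: PM | exact: phiM].
  + by exists 1; rewrite // -polyC1 phiC rmorph1.
  + case=> g Pg g1; apply: PN1.
    (* If [g] takes the value [-1] at [theta], then [g + 1] is a multiple of [p]. Multiples of [p]
       are in [T], so that [-1] would be in [P]. *)
    have /phi_dvdp/dvdpP[k gk] : phi (g + 1) = 0.
      by rewrite -[X in _ + X]opprK phiB g1 phiN -polyC1 phiC rmorph1 subrr.
    have -> : -1 = g + p * (- k) by rewrite mulrN [p * k]mulrC -gk; ring.
    apply: PD => //; apply: TP; exists 0; first by constructor.
    by exists (- k); rewrite add0r.
  + by move=> /pmP[g <-] /pmP[h <-]; apply/pmP; exists (g - h).
  + move=> /pmP[g <-]; apply/pmP.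
    have [g0|g0] := eqVneq (phi g) 0; first by exists g; rewrite g0 invr0.
    have cop : coprimep p g.
      apply: contraNT g0 => cop; have [_ /(_ _ cop (dvdp_gcdl _ _))] := p_irr.
      move=> /eqp_dvdl H; have := dvdp_gcdr p g; rewrite H => /dvdpP[k ->].
      by rewrite phiM [phi p](rootP ptheta) mulr0.
    have /Bezout_coprimepP[[u v] /= /eqpf_eq[c c0 uv]] := cop.
    exists (c^-1 *: v); apply: (mulIf g0); rewrite mulVf // -phiM.
    have -> : c^-1 *: v * g = 1 - c^-1%:P * u * p.
      have vg : v * g = c%:P - u * p by rewrite -alg_polyC -uv; ring.
      rewrite -scalerAl -mul_polyC vg.
      by rewrite mulrBr -polyCM mulVf // polyC1; ring.
    by rewrite phiB -polyC1 phiC phiM [phi p](rootP ptheta) mulr0 subr0 rmorph1.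
- move=> c c0; exists c%:P; last exact: phiC.
  apply: TP; exists c%:P; last by exists 0; rewrite mulr0 addr0.
  by have := wsos_sq 1 c0; rewrite expr1n alg_polyC.
- by apply/pmP; exists 'X; rewrite /phi map_polyX hornerX.
Qed.

End AdjoinRoot.

(** * Maximal ordered subfields of an algebraically closed field are real closed *)

Section MaximalOrderedSubfield.
Variables (E : closedFieldType) (S : {Q : set E | ordered_subfield Q}).
Hypothesis Smax : forall Q, ordered_subfield Q -> sval S `<=` Q -> Q = sval S.

Local Notation L := (osub S).

(** By induction on the degree. If [p] changes sign without a root in the interval, it is
    irreducible, since in a factorization one of the factors would change sign and have a root. The
    ordering thus extends to a root of [p] in [E], which maximality puts in [L]; but then [p] is
    linear and its root lies between [a] and [b]. *)
Lemma max_osub_ivt : Num.real_closed_axiom L.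
Proof.
move=> p; have [n] := ubnP (size p); elim: n => // n IHn in p *.
rewrite ltnS => sp a b ab /andP[pa pb].
apply: contrapT => noroot.
have {pa}pa : p.[a] < 0.
  rewrite lt_neqAle pa andbT; apply: contra_notN noroot => pa0.
  by exists a; rewrite ?lexx.
have {pb}pb : 0 < p.[b].
  rewrite lt_neqAle pb andbT eq_sym; apply: contra_notN noroot => pb0.
  by exists b; rewrite ?lexx ?andbT.
have IH (q : {poly L}) : (size q < size p)%N -> q.[a] * q.[b] <= 0 ->
    exists2 x, a <= x <= b & root q x.
  move=> sq; have [qa|qa] := leP q.[a] 0; last first.
    rewrite pmulr_rle0 // => qb.
    have [||x] := IHn (- q) _ a b ab; rewrite ?size_polyN ?(leq_trans sq) //.
      by rewrite !hornerN oppr_le0 oppr_ge0 ltW.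
    by rewrite rootN; exists x.
  move: qa; rewrite le_eqVlt => /orP[qa0 _|qa]; first by exists a; rewrite ?lexx.
  rewrite nmulr_rle0 // => qb.
  by apply: (IHn q) => //; rewrite ?(leq_trans sq) // ltW.
have p0 : p != 0 by apply: contraTneq pa => ->; rewrite horner0 ltxx.
have p_irr : irreducible_poly p.
  split=> [|q q1 qp].
    rewrite ltnNge; apply/negP => /size1_polyC pC.
    by move: (lt_trans pa pb); rewrite pC !hornerC ltxx.
  rewrite -dvdp_size_eqp // eqn_leq dvdp_leq //= leqNgt; apply/negP => sqp.
  have /dvdpP[r pE] := qp.
  have [q0 r0] : q != 0 /\ r != 0.
    by move: p0; rewrite pE mulf_eq0 negb_or => /andP[].
  have [qab|qab] := leP (q.[a] * q.[b]) 0.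
    have [x xab qx] := IH q sqp qab.
    by apply: noroot; exists x; rewrite // pE rootM qx orbT.
  have [||x xab rx] := IH r.
  - rewrite pE size_mul //; move: q1 q0; rewrite -size_poly_eq0.
    by case: (size q) => [|[|k]] // _ _; rewrite !addnS /= ltnS leq_addr.
  - by have := nmulr_rlt0 p.[b] pa; rewrite pb pE !hornerM mulrACA pmulr_llt0 // => /ltW.
  by apply: noroot; exists x; rewrite // pE rootM rx.
have [theta ptheta] : exists theta, root (map_poly (val : L -> E) p) theta.
  apply/closed_rootP; rewrite size_map_poly neq_ltn orbC.
  by have [-> _] := p_irr.
have [|Q [Qo SQ Qtheta]] := @adjoin_root L E (val : {rmorphism L -> E})
  p a b theta p_irr pa pb _ ptheta.
  move=> q sq /andP[qa qb]; have [|x] := IH q sq; last by exists x.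
  exact: mulr_le0_ge0.
(* By maximality, adjoining [theta] adds nothing: [theta] is already in [L]. *)
have {Qo}QS : Q = sval S.
  apply: Smax => // x Sx.
  have Px : osub_pred S x by apply/asboolP; left.
  by have := SQ (OSub Px); apply; apply/osub_ge0P.
have Ptheta : osub_pred S theta by apply/asboolP; rewrite -QS.
pose t : L := OSub Ptheta; have pt : root p t.
  by rewrite -(fmorph_root (val : {rmorphism L -> E})).
have /(_ ('X - t%:P)) := p_irr.2; rewrite size_XsubC dvdp_XsubCl => /(_ isT pt).
rewrite eqp_sym => /eqpf_eq[c c0 pE]; apply: noroot; exists t => //.
move: pa pb; rewrite pE !hornerZ !hornerXsubC; have [c1|c1] := ltP 0 c.
  by rewrite pmulr_rlt0 // pmulr_rgt0 // subr_lt0 subr_gt0 => /ltW -> /ltW ->.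
have {}c1 : c < 0 by rewrite lt_neqAle c0.
rewrite nmulr_rlt0 // nmulr_rgt0 // subr_lt0 subr_gt0 => ta bt.
by have := lt_le_trans (lt_trans bt ta) ab; rewrite ltxx.
Qed.

HB.instance Definition _ := Num.RealField_isClosed.Build L max_osub_ivt.

Lemma max_osub_rcf : exists (F : rcfType) (f : {rmorphism F -> E}),
  forall x, sval S x -> exists2 y, 0 <= y & f y = x.
Proof.
exists L, (val : {rmorphism L -> E}) => x Sx.
have Px : osub_pred S x by apply/asboolP; left.
by exists (OSub Px) => //; apply/osub_ge0P.
Qed.

End MaximalOrderedSubfield.

(** Ordered subfields are stable under unions of chains, so that [Q] lies in a maximal one, which is
    real closed. *)
Theorem real_closed_extension (E : closedFieldType) (Q : set E) :
  ordered_subfield Q -> exists (F : rcfType) (f : {rmorphism F -> E}),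
    forall x, Q x -> exists2 y, 0 <= y & f y = x.
Proof.
move=> Qo.
have [//|F [X0 FX0] Fo Ftot|M [Mo QM Mmax]] := @Zorn_above E Q (@ordered_subfield E).
  have F2 x y : (\bigcup_(X in F) X) x -> (\bigcup_(X in F) X) y ->
      exists X, [/\ F X, X x & X y].
    move=> [X FX Xx] [Y FY Yy]; have [XY|YX] := Ftot X Y FX FY.
      by exists Y; split=> //; exact: XY.
    by exists X; split=> //; exact: YX.
  have pmF x : pm (\bigcup_(X in F) X) x <-> exists2 X, F X & pm X x.
    split=> [[[X FX Xx]|[X FX Xx]]|[X FX [Xx|Xx]]].
    - by exists X => //; left.
    - by exists X => //; right.
    - by left; exists X.
    - by right; exists X.
  split=> [x y Fx /(F2 _ _ Fx)[X [FX Xx Xy]]|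
    x y Fx /(F2 _ _ Fx)[X [FX Xx Xy]]|||x y|x].
  - by exists X => //; apply: osub_add => //; apply: Fo.
  - by exists X => //; apply: osub_mul => //; apply: Fo.
  - by exists X0 => //; apply: osub_one; apply: Fo.
  - by case=> X /Fo /osub_N1.
  - move=> /pmF[X FX Xx] /pmF[Y FY Yy]; apply/pmF.
    have [XY|YX] := Ftot X Y FX FY.
      exists Y => //; apply: osub_pmB => //; first exact: Fo.
      by case: Xx => /XY; [left|right].
    exists X => //; apply: osub_pmB => //; first exact: Fo.
    by case: Yy => /YX; [left|right].
  - by move=> /pmF[X FX Xx]; apply/pmF; exists X => //; apply: osub_pmV => //; exact: Fo.
have [F [f fM]] := @max_osub_rcf E (exist _ M Mo) (fun Q' Qo' MQ' => Mmax Q' MQ' Qo').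
by exists F, f => x /QM /fM.
Qed.

(** * Real closed points of prime cones *)

Section ConeImage.
Variables (B : comNzRingType) (E : fieldType) (phi : {rmorphism B -> E}).
Variable P : set B.
Hypothesis P_prime : prime_cone P.
Hypothesis phi_ker : forall b, phi b = 0 <-> P b /\ P (- b).

(** Any fraction can be given a square as denominator, and its sign is then the one that [P] assigns
    to the numerator. *)
Lemma ordered_subfield_image : exists2 Q : set E, ordered_subfield Q &
  forall b, P b -> Q (phi b).
Proof.
have [[PD PM P2] tot _] := P_prime.
have P1 : P 1 by rewrite -[1](expr1n _ 2).
have phi1 : phi 1 != 0 by rewrite rmorph1 oner_eq0.
pose Q := [set x | exists b c, [/\ P b, phi c != 0 & x = phi b / phi c ^+ 2]].
have pmP x : pm Q x <-> exists b c, phi c != 0 /\ x = phi b / phi c ^+ 2.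
  split=> [[[b [c [_ c0 ->]]]|[b [c [_ c0 xE]]]]|[b [c [c0 ->]]]].
  - by exists b, c.
  - by exists (- b), c; rewrite rmorphN mulNr -xE opprK.
  - have [Pb|Pb] := tot b; [left|right].
      by exists b, c.
    by exists (- b), c; rewrite rmorphN mulNr.
exists Q; last by move=> b Pb; exists b, 1; rewrite rmorph1 expr1n divr1 oner_eq0.
split.
- move=> _ _ [b [c [Pb c0 ->]]] [b' [c' [Pb' c'0 ->]]].
  exists (b * c' ^+ 2 + b' * c ^+ 2), (c * c'); split.
  + by apply: (PD _ _); apply: (PM _ _).
  + by rewrite rmorphM mulf_neq0.
  + by rewrite !(rmorphD, rmorphXn, rmorphM) /=; field; apply/andP.
- move=> _ _ [b [c [Pb c0 ->]]] [b' [c' [Pb' c'0 ->]]].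
  exists (b * b'), (c * c'); split; first exact: (PM _ _).
    by rewrite rmorphM mulf_neq0.
  by rewrite !rmorphM /=; field; rewrite ?c0 ?c'0 ?b0.
- by exists 1, 1; rewrite rmorph1 expr1n divr1 oner_eq0.
- case=> b [c [Pb c0 E1]].
  (* From [-1 = phi b / phi c ^+ 2] it follows that [b + c ^+ 2] is in the support of [P]; then so
     is [c ^+ 2], against [phi c != 0]. *)
  have Pbc : phi (b + c ^+ 2) = 0.
    rewrite rmorphD rmorphXn; have -> : phi b = - phi c ^+ 2.
      by rewrite -mulN1r E1 divfK // expf_neq0.
    by rewrite addNr.
  move/negP: c0; apply.
  have [_ PNbc] := (phi_ker _).1 Pbc.
  have PNc2 : P (- c ^+ 2) by rewrite (_ : - _ = b + - (b + c ^+ 2)); [exact: PD|ring].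
  have /(phi_ker _).2 : P (c ^+ 2) /\ P (- c ^+ 2) by [].
  by rewrite rmorphXn => /eqP; rewrite expf_eq0.
- move=> x y /pmP[b [c [c0 ->]]] /pmP[b' [c' [c'0 ->]]]; apply/pmP.
  exists (b * c' ^+ 2 - b' * c ^+ 2), (c * c').
  rewrite rmorphM mulf_neq0 //; split=> //.
  by rewrite !(rmorphB, rmorphXn, rmorphM) /=; field; rewrite ?c0 ?c'0 ?b0.
- move=> x /pmP[b [c [c0 ->]]]; apply/pmP.
  have [b0|b0] := eqVneq (phi b) 0.
    by exists 0, 1; rewrite b0 rmorph0 !mul0r invr0.
  exists (b * c ^+ 2), b; split=> //.
  by rewrite !(rmorphXn, rmorphM) /=; field; rewrite ?c0 ?c'0 ?b0.
Qed.

End ConeImage.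

Lemma injective_pcancel (T : Type) (f : T -> nat) : injective f ->
  exists g, pcancel f g.
Proof.
move=> f_inj.
pose g n := if pselect (exists x, f x = n) is left h then Some (projT1 (cid h)) else None.
exists g => x; rewrite /g; case: pselect => [h|[]]; last by exists x.
by case: (cid h) => y /= /f_inj ->.
Qed.

(** * The residue field of a prime cone and a real closed extension of it *)

Section ResidueField.
Variables (B : comNzRingType) (P : set B).
Hypotheses (P_prime : prime_cone P) (PN1 : ~ P (-1)).

Definition cone_support : pred B := fun b => `[< P b /\ P (- b) >].

Lemma cone_support_idealr : idealr_closed cone_support.
Proof.
have [[PD PM P2] tot _] := P_prime.
have P0 : P 0 by have := P2 0; rewrite expr0n.
split; rewrite ?unfold_in /cone_support.
- by apply/asboolP; rewrite oppr0.
- by apply/asboolP => -[].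
- move=> a u v; rewrite !unfold_in => /asboolP[Pu PNu] /asboolP[Pv PNv].
  apply/asboolP; rewrite opprD.
  have [Pa|Pa] := tot a; split; apply: (PD _ _) => //.
  + exact: (PM _ _).
  + by rewrite -mulrN; exact: (PM _ _).
  + by rewrite -mulrNN; exact: (PM _ _).
  + by rewrite -mulNr; exact: (PM _ _).
Qed.

Lemma cone_support_prime : prime_idealr_closed cone_support.
Proof.
move=> u v; rewrite !unfold_in => /asboolP[Puv PNuv].
have [_ _ /(_ u v Puv PNuv)[]] := P_prime => H; apply/orP; [left|right];
  exact/asboolP.
Qed.

Definition cone_ideal : prime_idealr B := HB.pack cone_support
  (GRing.isZmodClosed.Build B cone_support
    (idealr_closedB cone_support_idealr))
  (isProperIdeal.Build B cone_support
    (idealr_closed_nontrivial cone_support_idealr))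
  (isPrimeIdealrClosed.Build B cone_support cone_support_prime).

Definition residue := {ideal_quot cone_ideal}.
HB.instance Definition _ := GRing.ComNzRing.on residue.

(** The field of fractions is built on an integral domain structure, which comprises units and
    inverses; these are chosen classically. *)
Let unit (x : residue) : bool := `[< exists y, y * x = 1 >].
Let inv (x : residue) : residue :=
  if pselect (exists y, y * x = 1) is left h then projT1 (cid h) else x.

Let mulVx : {in unit, left_inverse 1 inv *%R}.
Proof.
move=> x; rewrite unfold_in /unit /inv => /asboolP h; case: pselect => // h'.
by case: cid.
Qed.

Let unitPl (x y : residue) : y * x = 1 -> unit x.
Proof. by move=> xy; apply/asboolP; exists y. Qed.

Let invr_out : {in [predC unit], inv =1 id}.
Proof.
move=> x; rewrite inE /= unfold_in /unit /inv => /asboolP h.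
by case: pselect.
Qed.

HB.instance Definition _ := GRing.ComNzRing_hasMulInverse.Build residue
  mulVx unitPl invr_out.
HB.instance Definition _ := GRing.ComUnitRing_isIntegral.Build residue
  (@Quotient.rquot_IdomainAxiom _ cone_ideal).

Variables (code : B -> nat) (code_inj : injective code).

Definition residue_field := {fraction residue}.
HB.instance Definition _ := GRing.Field.on residue_field.

(** Countability of the residue field is what [countable_algebraic_closure] asks for. *)
Let fcode (x : residue_field) : nat :=
  let r := frac (repr x) in pickle (code (repr r.1), code (repr r.2)).

Let fcode_inj : injective fcode.
Proof.
move=> x y /(pcan_inj pickleK)[] /code_inj + /code_inj.
move=> /(can_inj reprK) E1 /(can_inj reprK) E2.
apply: (can_inj reprK); apply: val_inj.
by rewrite [LHS]surjective_pairing [RHS]surjective_pairing E1 E2.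
Qed.

HB.instance Definition _ := isCountable.Build residue_field
  (projT2 (cid (injective_pcancel fcode_inj))).

(** The ring [B] maps to the algebraic closure [E] of the residue field. The cone [P] induces an
    ordering there, contained in that of a real closed subfield [F]. As [P] and its opposite cover
    [B], the map to [E] factors through [F]. *)
Theorem prime_cone_point : exists (F : rcfType) (f : {rmorphism B -> F}),
  forall b, (0 <= f b) = `[< P b >].
Proof.
have [E [iota _]] := countable_algebraic_closure residue_field.
pose piB : {rmorphism B -> residue} := \pi_residue%qT.
pose frac : {rmorphism residue -> residue_field} := @FracField.tofrac residue.
pose phi : {rmorphism B -> E} := iota \o (frac \o piB).
have phi_ker b : phi b = 0 <-> P b /\ P (- b).
  have -> : phi b = 0 <-> cone_support b.
    rewrite /= (rwP eqP) fmorph_eq0 -(rmorph0 (@FracField.tofrac residue)).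
    rewrite tofrac_eq -(rmorph0 piB) /piB /= piE Quotient.equivE subr0.
    by [].
  by split=> /asboolP.
have [Q Qo QP] := ordered_subfield_image P_prime phi_ker.
have [F [f fQ]] := real_closed_extension Qo.
have [[PD PM P2] tot _] := P_prime.
have j_ex b : exists y, f y = phi b.
  have [/QP/fQ[y _ fy]|/QP/fQ[y _ fy]] := tot b; first by exists y.
  by exists (- y); rewrite rmorphN fy rmorphN opprK.
pose j b := projT1 (cid (j_ex b)).
have jE b : f (j b) = phi b by rewrite /j; case: cid.
have jB : zmod_morphism j.
  by move=> b c; apply: (fmorph_inj f); rewrite rmorphB !jE rmorphB.
have jM : monoid_morphism j.
  split=> [|b c]; apply: (fmorph_inj f); first by rewrite jE !rmorph1.
  by rewrite rmorphM !jE rmorphM.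
pose jm : {rmorphism B -> F} := HB.pack j (GRing.isZmodMorphism.Build B F j jB)
  (GRing.isMonoidMorphism.Build B F j jM).
have jP b : P b -> 0 <= j b.
  by move=> /QP/fQ[y y0 fy]; rewrite (_ : j b = y) //; apply: (fmorph_inj f);
    rewrite jE fy.
exists F, jm => b; apply/idP/asboolP; last exact: jP.
(* If [- b] is in [P] and [j b] is nonnegative, then [j b = 0], so that [b] is in the support and in
   particular in [P]. *)
move=> jb; have [//|/jP jNb] := tot b.
have /phi_ker[] // : phi b = 0.
rewrite -jE (_ : j b = 0) ?rmorph0 //; apply/eqP; rewrite eq_le [0 <= _]jb andbT.
by rewrite -oppr_ge0 -(rmorphN jm).
Qed.

End ResidueField.

(** * The real Nullstellensatz *)

Section EvalTerm.
Variable A : comNzRingType.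
Implicit Types (r : rat -> A) (e : seq A).

(** Evaluation takes place in any commutative ring, so that terms also make sense in polynomial
    rings; [r] interprets the rational constants. *)
Fixpoint eval_term r e (t : qe_rcf.term rat) : A :=
  match t with
  | qe_rcf.Var i => e`_i
  | qe_rcf.Const c => r c
  | qe_rcf.NatConst n => n%:R
  | qe_rcf.Add u v => eval_term r e u + eval_term r e v
  | qe_rcf.Opp u => - eval_term r e u
  | qe_rcf.NatMul u n => eval_term r e u *+ n
  | qe_rcf.Mul u v => eval_term r e u * eval_term r e v
  | qe_rcf.Exp u n => eval_term r e u ^+ n
  end.

Lemma eq_eval_term r r' e t : r =1 r' -> eval_term r e t = eval_term r' e t.
Proof.
by move=> rr'; elim: t => //= [t -> u ->|t ->|t -> n|t -> u ->|t -> n].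
Qed.

End EvalTerm.

Lemma rmorph_eval_term (A A' : comNzRingType) (g : {rmorphism A -> A'})
    (r : rat -> A) (e : seq A) t :
  g (eval_term r e t) = eval_term (g \o r) (map g e) t.
Proof.
elim: t => //=.
- by move=> i; have := nth_map_default g 0 e i; rewrite rmorph0 => ->.
- by move=> n; rewrite rmorph_nat.
- by move=> t <- u <-; rewrite rmorphD.
- by move=> t <-; rewrite rmorphN.
- by move=> t <- n; rewrite rmorphMn.
- by move=> t <- u <-; rewrite rmorphM.
- by move=> t <- n; rewrite rmorphXn.
Qed.

Lemma eval_ratE (F : rcfType) (e : seq F) t : eval_rat e t = eval_term ratr e t.
Proof.
rewrite /eval_rat.
by elim: t => //= [t -> u ->|t ->|t -> n|t -> u ->|t -> n].
Qed.

Section TermOfPoly.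
Variables (R : comNzRingType) (n : nat) (cs : seq R).
Implicit Types (p : {mpoly R[n]}) (m : multinom n).

(** The variables of index below [size cs] stand for the coefficients listed in [cs], the next [n]
    for the indeterminates. Real coefficients thus become parameters of a rational term. *)
Definition term_of_mnm m : qe_rcf.term rat :=
  \big[(@qe_rcf.Mul rat)/qe_rcf.NatConst rat 1]_(j < n)
    qe_rcf.Exp (qe_rcf.Var rat (size cs + j)) (m j).

Definition term_of_mpoly p : qe_rcf.term rat :=
  \big[(@qe_rcf.Add rat)/qe_rcf.NatConst rat 0]_(m <- msupp p)
    qe_rcf.Mul (qe_rcf.Var rat (index (mcoeff m p) cs)) (term_of_mnm m).

Lemma eval_term_of_mpoly r p : {subset [seq mcoeff m p | m <- msupp p] <= cs} ->
  eval_term r ([seq c%:MP | c <- cs] ++ [seq mpolyX R (mnm1 i) | i <- enum 'I_n])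
    (term_of_mpoly p) = p.
Proof.
move=> p_cs; rewrite [RHS]mpolyE /term_of_mpoly.
set e := _ ++ _.
rewrite (big_morph (eval_term r e) (id1 := 0) (op1 := +%R)) //=.
rewrite [LHS]big_seq [RHS]big_seq; apply: eq_bigr => m mp.
have cP : mcoeff m p \in cs by apply: p_cs; apply: map_f.
rewrite -mul_mpolyC; congr (_ * _).
  by rewrite nth_cat size_map index_mem cP (nth_map 0) ?index_mem // nth_index.
rewrite /term_of_mnm (big_morph (eval_term r e) (id1 := 1) (op1 := *%R)) //=.
rewrite mpolyXE_id; apply: eq_bigr => j _ /=; congr (_ ^+ _).
rewrite nth_cat size_map ltnNge leq_addr /= addKn.
by rewrite (nth_map j) ?size_enum_ord // nth_ord_enum.
Qed.

End TermOfPoly.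

Lemma mpoly_rat_code N : exists code : {mpoly rat[N]} -> nat, injective code.
Proof.
exists (fun q => pickle [seq (m, mcoeff m q) | m <- msupp q]) => p q.
move=> /(pcan_inj pickleK) pq; rewrite (mpolyE p) (mpolyE q).
have E (r : {mpoly rat[N]}) : \sum_(m <- msupp r) mcoeff m r *: mpolyX _ m =
    \sum_(x <- [seq (m, mcoeff m r) | m <- msupp r]) x.2 *: mpolyX _ x.1.
  by rewrite [RHS]big_map.
by rewrite !E pq.
Qed.

Section RealNullstellensatz.
Variables (R : realType) (n s : nat) (p : 'I_s -> {mpoly R[n]}).
Variable k : {mpoly R[n]}.
Local Notation I := (ideal_gen p).

Lemma ideal_gen0 : I 0.
Proof. by exists (fun=> 0); rewrite big1 // => l _; rewrite mul0r. Qed.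

Lemma ideal_genD x y : I x -> I y -> I (x + y).
Proof.
move=> [u ->] [v ->]; exists (fun l => u l + v l).
by rewrite -big_split; apply: eq_bigr => l _ /=; rewrite mulrDl.
Qed.

Lemma ideal_genMl a x : I x -> I (a * x).
Proof.
move=> [u ->]; exists (fun l => a * u l).
by rewrite mulr_sumr; apply: eq_bigr => l _; rewrite mulrA.
Qed.

Lemma ideal_genN x : I x -> I (- x).
Proof. by move=> Ix; rewrite -mulN1r; apply: ideal_genMl. Qed.

Lemma mem_ideal_gen l : I (p l).
Proof.
exists (fun i => (i == l)%:R); rewrite (bigD1 l) //= eqxx mul1r big1 ?addr0 //.
by move=> i /negbTE ->; rewrite mul0r.
Qed.

Lemma is_sosD (x y : {mpoly R[n]}) : is_sos x -> is_sos y -> is_sos (x + y).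
Proof. by move=> [u ->] [v ->]; exists (u ++ v); rewrite big_cat. Qed.

Lemma is_sosM (x y : {mpoly R[n]}) : is_sos x -> is_sos y -> is_sos (x * y).
Proof.
move=> [u ->] [v ->]; exists [seq a * b | a <- u, b <- v].
rewrite big_allpairs_dep big_distrlr; apply: eq_bigr => a _; apply: eq_bigr => b _.
by rewrite exprMn.
Qed.

Lemma is_sos_sqr (x : {mpoly R[n]}) : is_sos (x ^+ 2).
Proof. by exists [:: x]; rewrite big_seq1. Qed.

(* The preimage of the preordering generated by [I] in the localization at [k]. *)
Let T : set {mpoly R[n]} := [set x | exists a sigma i,
  [/\ is_sos sigma, I i & k ^+ (2 * a) * x = sigma + i]].

Let T_preordering : preordering T.
Proof.
have k_sos a : is_sos (k ^+ (2 * a)) by rewrite mulnC exprM; apply: is_sos_sqr.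
split=> [x y [a [u [i [Su Ii xE]]]] [b [v [j [Sv Ij yE]]]]|
  x y [a [u [i [Su Ii xE]]]] [b [v [j [Sv Ij yE]]]]|x].
- exists (a + b)%N, (k ^+ (2 * b) * u + k ^+ (2 * a) * v),
    (k ^+ (2 * b) * i + k ^+ (2 * a) * j); split.
  + by apply: is_sosD; apply: is_sosM.
  + by apply: ideal_genD; apply: ideal_genMl.
  + rewrite mulnDr exprD; move: xE yE.
    move: (k ^+ (2 * a)) (k ^+ (2 * b)) => A B xE yE.
    have -> : A * B * (x + y) = B * (A * x) + A * (B * y) by ring.
    by rewrite xE yE; ring.
- exists (a + b)%N, (u * v), (u * j + v * i + j * i); split.
  + exact: is_sosM.
  + by apply: ideal_genD; [apply: ideal_genD|]; apply: ideal_genMl.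
  + rewrite mulnDr exprD; move: xE yE.
    move: (k ^+ (2 * a)) (k ^+ (2 * b)) => A B xE yE.
    have -> : A * B * (x * y) = (A * x) * (B * y) by ring.
    by rewrite xE yE; ring.
- exists 0%N, (x ^+ 2), 0; split; [exact: is_sos_sqr|exact: ideal_gen0|].
  by rewrite muln0 expr0 mul1r addr0.
Qed.

Theorem real_nullstellensatz :
    (forall x : 'I_n -> R, (forall l, (p l).@[x] = 0) -> k.@[x] = 0) ->
  exists a sigma, is_sos sigma /\ I (k ^+ (2 * a) + sigma).
Proof.
move=> k_zero; apply: contrapT => nS.
have TN a : ~ T (- k ^+ (2 * a)).
  case=> b [sigma [i [Ss Ii E]]]; apply: nS; exists (a + b)%N, sigma; split=> //.
  have -> : k ^+ (2 * (a + b)) + sigma = - i.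
    rewrite mulnDr exprD [_ * _]mulrC -[LHS]opprK opprD -mulrN E.
    by ring.
  exact: ideal_genN.
have [P [P_prime TP Pk]] := prime_cone_extension T_preordering TN.
have [[PD PM P2] Ptot Psupp] := P_prime.
(* The list of all coefficients of [k] and of the [p l]. *)
pose cs := flatten [seq [seq mcoeff m q | m <- msupp q]
  | q <- k :: [seq p l | l <- enum 'I_s]].
pose N := size cs.
have cs_sub q : q \in k :: [seq p l | l <- enum 'I_s] ->
    {subset [seq mcoeff m q | m <- msupp q] <= cs}.
  move=> qk c cq; apply/flattenP.
  by exists [seq mcoeff m q | m <- msupp q] => //; apply/mapP; exists q.
pose r : rat -> {mpoly R[n]} := fun c => (ratr c)%:MP.
pose h (i : 'I_(N + n)) : {mpoly R[n]} := match fintype.split i with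
  inl j => (cs`_j)%:MP | inr j => mpolyX R (mnm1 j) end.
(* The image of [psi] is the subring generated over the rationals by [cs] and the indeterminates.
   The cone [P] is pulled back along [psi] to a countable ring. *)
pose psi : {rmorphism {mpoly rat[N + n]} -> {mpoly R[n]}} :=
  mmap (@mpolyC n R \o (@ratr R : {rmorphism rat -> R})) h.
pose X i : {mpoly rat[N + n]} := mpolyX rat (mnm1 i).
have psiX i : psi (X i) = h i by rewrite /psi /= mmapX mmap1U.
have psiC c : psi c%:MP = r c by rewrite /psi /= mmapC.
pose envC := [seq X (lshift n i) | i <- enum 'I_N].
pose envX := [seq X (rshift N j) | j <- enum 'I_n].
have psi_envC : map psi envC = [seq c%:MP | c <- cs].
  rewrite -map_comp -[in RHS](mkseq_nth 0 cs) /mkseq -val_enum_ord -!map_comp.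
  apply: eq_map => i /=; rewrite psiX /h.
  by have := unsplitK (inl i : 'I_N + 'I_n) => /= ->.
have psi_envX : map psi envX = [seq mpolyX R (mnm1 j) | j <- enum 'I_n].
  rewrite -map_comp; apply: eq_map => j /=; rewrite psiX /h.
  by have := unsplitK (inr j : 'I_N + 'I_n) => /= ->.
pose PB := [set b | P (psi b)].
have PB_prime : prime_cone PB.
  split; last first.
  - by move=> x y; rewrite /PB /= !rmorphN !rmorphM; apply: Psupp.
  - by move=> x; rewrite /PB /= rmorphN; apply: Ptot.
  - split=> [x y|x y|x]; rewrite /PB /=.
    + by rewrite rmorphD; exact: PD.
    + by rewrite rmorphM; exact: PM.
    + by rewrite rmorphXn; exact: P2.
have PBN1 : ~ PB (-1).
  by rewrite /PB /= rmorphN rmorph1; have := Pk 0%N; rewrite muln0 expr0.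
have [code code_inj] := mpoly_rat_code (N + n).
have [F [f fP]] := prime_cone_point PB_prime PBN1 code_inj.
pose evB := eval_term (@mpolyC _ _ : rat -> {mpoly rat[N + n]}).
have fE e t : eval_rat (map f e) t = f (evB e t).
  rewrite eval_ratE rmorph_eval_term; apply: eq_eval_term => c.
  by rewrite -(fmorph_eq_rat (f \o @mpolyC (N + n) rat)). 
have psiE e t : psi (evB e t) = eval_term r (map psi e) t.
  by rewrite rmorph_eval_term; apply: eq_eval_term => c /=; rewrite psiC.
have evC t : eval_term r [seq c%:MP | c <- cs] t = (eval_rat cs t)%:MP.
  by rewrite eval_ratE (rmorph_eval_term (@mpolyC n R)).
(* On constants [P] induces the order of [R]: a nonnegative real is a square, and a negative [c] in
   [P] would put [-1], the product of [c] and the square of a real root of [- c^-1], in [P]. *)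
have PC c : P c%:MP <-> 0 <= c.
  split=> [Pc|c0]; last first.
    by rewrite -(sqr_sqrtr c0) rmorphXn; apply: P2.
  rewrite leNgt; apply/negP => c0.
  have cV : 0 <= - c^-1 by rewrite oppr_ge0 invr_le0 ltW.
  have := Pk 0%N; rewrite muln0 expr0; apply.
  rewrite (_ : -1 = c%:MP * (Num.sqrt (- c^-1))%:MP ^+ 2); last first.
    rewrite -rmorphXn sqr_sqrtr // -rmorphM mulrN mulfV ?lt_eqF //.
    by rewrite rmorphN rmorph1.
  by apply: PM => //; apply: P2.
pose ts := [seq term_of_mpoly cs q | q <- k :: [seq p l | l <- enum 'I_s]].
have [us usP] := sign_elimination_seq ts N n.
(* Signs in [F] are read off [P], which on constants agrees with the order of [R]: the parameters
   look the same in [F] and in [R]. *)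
have C_signs : same_signs (map f envC) cs us.
  apply: sub_all (all_predT us) => t _ /=; apply/eqP; rewrite fE.
  have P0 b : (0 <= f b) = `[< P (psi b) >] by rewrite fP.
  move: (P0 (evB envC t)) (P0 (- evB envC t)); rewrite !rmorphN oppr_ge0.
  rewrite psiE psi_envC evC -rmorphN.
  move: (f _) (eval_rat _ _) => x c.
  rewrite !(asbool_equiv_eq (PC _)) asboolb oppr_ge0 asboolb.
  by case: (sgzP x) => ?; case: (sgzP c) => ?.
(* The images of the indeterminates form a point over [F]; the elimination replaces it with a point
   [x2] over [R] at which the terms of [ts] have the same signs. *)
have [|//||x2 sx2 x_signs] := usP _ _ _ _ _ _ C_signs (map f envX).
- by rewrite 2!size_map size_enum_ord.
- by rewrite 2!size_map size_enum_ord.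
pose env := [seq (c%:MP : {mpoly R[n]}) | c <- cs] ++
  [seq mpolyX R (mnm1 j) | j <- enum 'I_n].
have q_sign q : q \in k :: [seq p l | l <- enum 'I_s] ->
    q.@[fun i : 'I_n => x2`_i] = 0 <-> P q /\ P (- q).
  move=> qk; have := x_signs; rewrite /ts /same_signs all_map => /allP/(_ q qk).
  rewrite /= -map_cat fE => /eqP.
  have qE r' : eval_term r' env (term_of_mpoly cs q) = q.
    by apply: eval_term_of_mpoly; apply: cs_sub.
  have -> : eval_rat (cs ++ x2) (term_of_mpoly cs q) = q.@[fun i : 'I_n => x2`_i].
    rewrite -[in RHS](qE (@mpolyC n R \o ratr)).
    rewrite (rmorph_eval_term (meval (fun i : 'I_n => x2`_i))) eval_ratE.
    rewrite (@eq_eval_term _ _ ratr) => [|c /=]; last by rewrite mevalC.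
    rewrite map_cat; congr (eval_term _ (_ ++ _) _).
      rewrite -map_comp -[LHS]map_id; apply: eq_map => c /=.
      by rewrite mevalC.
    rewrite -map_comp -[LHS](mkseq_nth 0) sx2 /mkseq -val_enum_ord -map_comp.
    by apply: eq_map => j /=; rewrite mevalXU.
  have fb0 b : sgz (f b) = 0 <-> P (psi b) /\ P (- psi b).
    rewrite -rmorphN -[P (psi b)]/(PB b) -[P (psi _)]/(PB (- b)).
    have -> : PB b = (0 <= f b) :> Prop by rewrite fP asboolE.
    have -> : PB (- b) = (0 <= f (- b)) :> Prop by rewrite fP asboolE.
    by rewrite rmorphN oppr_ge0; case: (sgzP (f b)) => ? /=; split=> // -[].
  have := fb0 (evB (envC ++ envX) (term_of_mpoly cs q)).
  rewrite psiE map_cat psi_envC psi_envX qE => {}fb0 sgE.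
  by rewrite -fb0 sgE (rwP eqP) (rwP (eqP : reflect (sgz _ = 0) _)) sgz_eq0.
have IP x : I x -> P x.
  by move=> Ix; apply: TP; exists 0%N, 0, x; rewrite add0r expr0 mul1r;
    split=> //; exists [::]; rewrite big_nil.
(* Each [p l] is in the support of [P] and vanishes at [x2]; hence so does [k] by assumption, and
   [k] is in the support. Then [- k ^+ 2] is in [P], a contradiction. *)
have /(q_sign k (mem_head _ _))[Pk1 PNk1] : k.@[fun i : 'I_n => x2`_i] = 0.
  apply: k_zero => l; apply/q_sign.
    by rewrite inE; apply/orP; right; apply: map_f; rewrite mem_enum.
  by split; apply: IP; [|apply: ideal_genN]; apply: mem_ideal_gen.
by apply: (Pk 1%N); rewrite muln1 expr2 -mulrN; apply: PM.
Qed.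

End RealNullstellensatz.

(** * Degrees, sums of squares and Groebner bases *)

Section Degree.
Variables (R : realType) (n : nat).
Implicit Types (p q : {mpoly R[n]}).

Lemma mdegree_mlead p : mdegree p = mdeg (mlead p).
Proof.
rewrite /mdegree; have [->|p0] := eqVneq p 0.
  by rewrite mmeasure0 mlead0 mdeg0.
by rewrite -mlead_deg.
Qed.

Lemma mdegree_leP p d :
  reflect (forall m, m \in msupp p -> (mdeg m <= d)%N) (mdegree p <= d)%N.
Proof.
rewrite mdegree_mlead; apply: (iffP idP) => [pd m /msupp_le_mlead|pd].
  by move=> /lemc_mdeg/leq_trans; apply.
have [->|/mlead_supp/pd//] := eqVneq p 0.
by rewrite mlead0 mdeg0.
Qed.

Lemma mdegreeD_le p q d :
  (mdegree p <= d)%N -> (mdegree q <= d)%N -> (mdegree (p + q)%R <= d)%N.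
Proof.
rewrite !mdegree_mlead => pd qd; have /lemc_mdeg/leq_trans := mleadD_le p q.
by apply; rewrite mdeg_max geq_max pd.
Qed.

Lemma mdegreeM_le p q d e :
  (mdegree p <= d)%N -> (mdegree q <= e)%N -> (mdegree (p * q)%R <= d + e)%N.
Proof.
rewrite !mdegree_mlead => pd qe; have /lemc_mdeg/leq_trans := mleadM_le p q.
by apply; rewrite mdegD leq_add.
Qed.

Lemma mdegreeC c : mdegree (c%:MP : {mpoly R[n]}) = 0%N.
Proof. by rewrite mdegree_mlead mleadC mdeg0. Qed.

Lemma mdegree0 : mdegree (0 : {mpoly R[n]}) = 0%N.
Proof. by rewrite mdegree_mlead mlead0 mdeg0. Qed.

Lemma mdegreeN p : mdegree (- p) = mdegree p.
Proof. by rewrite !mdegree_mlead mleadN. Qed.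

Lemma mdegreeZ_le c p d : (mdegree p <= d)%N -> (mdegree (c *: p)%R <= d)%N.
Proof.
by rewrite -mul_mpolyC => pd; rewrite -[d]add0n mdegreeM_le ?mdegreeC.
Qed.

Lemma mdegreeX (m : multinom n) : mdegree (mpolyX R m) = mdeg m.
Proof. by rewrite mdegree_mlead mleadXm. Qed.

Lemma mdegree_sum_le (I : Type) (r : seq I) (P : pred I)
    (F : I -> {mpoly R[n]}) d : (forall i, P i -> (mdegree (F i) <= d)%N) ->
  (mdegree (\sum_(i <- r | P i) F i)%R <= d)%N.
Proof.
move=> Fd; elim/big_ind: _ => [|x y|i /Fd//]; first by rewrite mdegree0.
exact: mdegreeD_le.
Qed.

Lemma mdegree_sqr_le p d :
  (mdegree p <= d)%N -> (mdegree (p ^+ 2)%R <= 2 * d)%N.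
Proof. by move=> pd; rewrite expr2 mul2n -addnn mdegreeM_le. Qed.

Lemma sos_term_mdegree (qs : seq {mpoly R[n]}) d :
    (mdegree (\sum_(q <- qs) q ^+ 2)%R <= 2 * d)%N ->
  forall q, q \in qs -> (mdegree q <= d)%N.
Proof.
move=> sd q0 q0qs.
have [q [qqs qmax]] : exists q, q \in qs /\
    forall q', q' \in qs -> (mlead q' <= mlead q)%O.
  elim: qs q0 q0qs {sd} => // a [|b l] IH q0 _.
    by exists a; split=> [|q']; rewrite ?mem_head // inE => /eqP ->.
  have [|q [ql qmax]] := IH b; first by rewrite mem_head.
  have [aq|/ltW qa] := leP (mlead a) (mlead q).
    exists q; split=> [|q']; first by rewrite inE ql orbT.
    by rewrite inE => /orP[/eqP -> //|/qmax].
  exists a; split=> [|q']; first by rewrite mem_head.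
  by rewrite inE => /orP[/eqP -> //|/qmax/le_trans]; apply.
rewrite mdegree_mlead (leq_trans (lemc_mdeg (qmax _ q0qs))) // leqNgt.
apply/negP => dq; set mu := mlead q in dq qmax.
have q_neq0 : q != 0 by apply: contraTneq dq => q0E; rewrite /mu q0E mlead0 mdeg0.
(* The leading squares add up without cancellation. *)
have : mcoeff (mnm_add mu mu) (\sum_(q <- qs) q ^+ 2) != 0.
  rewrite raddf_sum /= gt_eqF // (big_rem q) //= ltr_pwDl //.
    by rewrite expr2 mleadcMW // -expr2 exprn_even_gt0 //= mleadc_eq0.
  rewrite big_seq; apply: sumr_ge0 => q' /mem_rem /qmax q'mu.
  by rewrite expr2 mleadcMW // -expr2 sqr_ge0.
rewrite -mcoeff_msupp => /(mdegree_leP _ _ sd).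
by rewrite mdegD addnn -mul2n leq_mul2l leqNgt dq.
Qed.

End Degree.

Section Groebner.
Variables (R : realType) (n s : nat) (p : 'I_s -> {mpoly R[n]}).

(** Division by [p], by well-founded induction on the leading monomial. The multiple [u * p l] that
    cancels the leading term of [q] has the same leading monomial as [q], hence the same degree
    because the order is graded. *)
Lemma groebner_trunc_ideal t q : groebner_basis p (ideal_gen p) ->
  ideal_gen p q -> (mdegree q <= 2 * t)%N -> trunc_ideal t p q.
Proof.
move=> [_ Gp]; move: q.
suff H mu q : mlead q = mu -> ideal_gen p q -> (mdegree q <= 2 * t)%N ->
    trunc_ideal t p q by move=> q; apply: H.
elim/(well_founded_ind (@ltom_wf n)): mu q => mu IH q q_mu Iq qt.
have [->|q0] := eqVneq q 0.
  by exists (fun=> 0); split=> [l|]; rewrite ?big1 // => *;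
    rewrite mul0r ?mdegree0.
have [l [pl0 pl_q]] := Gp q Iq q0.
pose nu := mnm_sub mu (mlead (p l)).
pose c := mcoeff mu q / mcoeff (mlead (p l)) (p l).
pose u := c *: mpolyX R nu.
have nuE : mnm_add nu (mlead (p l)) = mu.
  by apply/mnmP => i; rewrite mnmDE mnmBE subnK // -q_mu.
have c0 : c != 0 by rewrite mulf_neq0 ?invr_eq0 // -?q_mu mleadc_eq0.
have lu : mlead u = nu by rewrite mleadZ // mleadXm.
have lup : mlead (u * p l) = mu.
  by rewrite mleadM ?lu // -mleadc_eq0 lu mcoeffZ mcoeffX eqxx mulr1.
have cup : mcoeff mu (u * p l) = mcoeff mu q.
  rewrite -{1}nuE mleadcMW ?lu // mcoeffZ mcoeffX eqxx mulr1 /c.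
  by rewrite divfK // mleadc_eq0.
have Iup : ideal_gen p (q - u * p l).
  by apply: ideal_genD => //; apply: ideal_genN; apply: ideal_genMl;
    apply: mem_ideal_gen.
have upt : (mdegree (u * p l)%R <= 2 * t)%N.
  by rewrite mdegree_mlead lup -q_mu -mdegree_mlead.
have q't : (mdegree (q - u * p l)%R <= 2 * t)%N.
  by rewrite mdegreeD_le // mdegreeN.
have [k [kt qE]] : trunc_ideal t p (q - u * p l).
  (* A zero remainder is treated apart: [mlead 0] is the monomial 1, which is not smaller than [mu]
     when [mu] is 1 itself. *)
  have [q'0|q'0] := eqVneq (q - u * p l) 0.
    by exists (fun=> 0); split=> [i|]; rewrite ?big1 // => *;
      rewrite mul0r ?mdegree0.
  apply: (IH (mlead (q - u * p l))) => //.
  rewrite lt_neqAle; apply/andP; split; last first.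
    by rewrite (le_trans (mleadB_le _ _)) // leUx q_mu lup lexx.
  apply: contraNneq q'0 => q'mu; rewrite -mleadc_eq0 q'mu mcoeffB cup.
  by rewrite subrr.
exists (fun i => k i + (if i == l then u else 0)); split=> [i|].
  rewrite mulrDl mdegreeD_le //; case: eqP => [->//|_].
  by rewrite mul0r mdegree0.
under eq_bigr do rewrite mulrDl; rewrite big_split /= -qE.
rewrite (bigD1 l) //= eqxx big1 ?addr0 ?subrK // => i /negbTE ->.
by rewrite mul0r.
Qed.

End Groebner.

(** * Polynomials vanishing on a set *)

Lemma poly_eq0_near0 (R : realFieldType) (p : {poly R}) (e : R) : 0 < e ->
  (forall s, 0 < s < e -> p.[s] = 0) -> p = 0.
Proof.
move=> e0 pe; apply: contrapT => /eqP p0.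
(* These are [size p] distinct roots, more than the degree allows; the shift by 2 keeps them
   strictly below [e]. *)
pose rs := [seq e / (i.+2)%:R | i <- iota 0 (size p)].
have := @max_poly_roots _ p rs p0; rewrite size_map size_iota ltnn => H.
suff : false by []; apply: H.
  apply/allP => _ /mapP[i _ ->]; apply/rootP/pe.
  rewrite divr_gt0 ?ltr0n //= ltr_pdivrMr ?ltr0n // ltr_pMr // ltr1n.
  by [].
rewrite map_inj_uniq ?iota_uniq // => i j /(mulfI (lt0r_neq0 e0))/invr_inj/eqP.
by rewrite eqr_nat => /eqP[].
Qed.

Lemma digits_inj D n (f g : 'I_n -> nat) :
    (forall i, (f i < D)%N) -> (forall i, (g i < D)%N) ->
  (\sum_i f i * D ^ i = \sum_i g i * D ^ i)%N -> f =1 g.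
Proof.
elim: n f g => [|n IHn] f g fD gD; first by move=> _ [].
rewrite !big_ord_recl /= !expn0 !muln1.
have recE h : (\sum_(i < n) h (lift ord0 i) * D ^ bump 0 i =
    D * \sum_(i < n) h (lift ord0 i) * D ^ i)%N.
  rewrite big_distrr; apply: eq_bigr => i _.
  by rewrite /bump leq0n add1n expnS mulnCA.
rewrite !recE => E.
have E0 : f ord0 = g ord0.
  have := congr1 (modn^~ D) E.
  by rewrite /= !(addnC _ (D * _)%N) !(mulnC D) !modnMDl !modn_small.
move=> i; case: (unliftP ord0 i) => [j ->|->] //.
apply: (IHn (f \o lift ord0) (g \o lift ord0)) => [k|k|]; rewrite ?fD ?gD //=.
have D0 : (0 < D)%N by rewrite (leq_ltn_trans _ (fD ord0)).
by move/eqP: E; rewrite E0 eqn_add2l eqn_pmul2l // => /eqP.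
Qed.

Section Vanishing.
Variables (R : realType) (n : nat).
Implicit Types (p : {mpoly R[n]}).

Lemma horner_mmap (h : 'I_n -> {poly R}) p s :
  (mmap polyC h p).[s] = p.@[fun i => (h i).[s]].
Proof.
rewrite /meval /mmap horner_sum; apply: eq_bigr => m _.
rewrite hornerM hornerC /mmap1 horner_prod; congr (_ * _).
by apply: eq_bigr => i _; rewrite horner_exp.
Qed.

Lemma mpoly_fun_eq0 p : (forall x, p.@[x] = 0) -> p = 0.
Proof.
move=> p0; pose D := (mdegree p).+1.
pose kappa (m : multinom n) := (\sum_i m i * D ^ i)%N.
(* Kronecker substitution: the monomials of [p] have distinct images. *)
pose Q := mmap polyC (fun i : 'I_n => 'X^(D ^ i)) p.
have Q0 : Q = 0.
  by apply: (@poly_eq0_near0 _ _ 1) => // s _; rewrite horner_mmap.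
have QE : Q = \sum_(m <- msupp p) (mcoeff m p) *: 'X^(kappa m).
  rewrite /Q /mmap; apply: eq_bigr => m _; rewrite mul_polyC; congr (_ *: _).
  rewrite /mmap1 /kappa -prodrXr.
  by apply: eq_bigr => i _; rewrite -exprM mulnC.
have digit m i : m \in msupp p -> (m i < D)%N.
  move=> /(mdegree_leP _ _ (leqnn _)); rewrite ltnS; apply: leq_trans.
  by rewrite mdegE (bigD1 i) //= leq_addr.
apply/mpolyP => m; rewrite mcoeff0; apply: contrapT => /eqP mp.
have {}mp : m \in msupp p by rewrite mcoeff_msupp.
have := congr1 (fun q : {poly R} => q`_(kappa m)) Q0; rewrite QE coef0 coef_sum.
rewrite (bigD1_seq m) ?msupp_uniq //= coefZ coefXn eqxx mulr1.
rewrite big_seq_cond big1 ?addr0 => [/eqP|m' /andP[m'p m'm]].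
  by rewrite mcoeff_eq0 mp.
rewrite coefZ coefXn; case: eqP => [/digits_inj E|_]; last by rewrite mulr0.
by case/eqP: m'm; apply/mnmP => i; rewrite E // => j; apply: digit.
Qed.

(** On the line from an interior point [a] to any point [v], [p] is a polynomial in one variable
    that vanishes at all small positive parameters. Hence it is zero, and its value at parameter 1
    is the value of [p] at [v]. *)
Lemma mpoly_interior_eq0 (X : set 'rV[R]_n) p : X^° !=set0 ->
  (forall x, X x -> p.@[x ord0] = 0) -> p = 0.
Proof.
case=> a /nbhs_ballP[e /= e0 Xe] pX; apply: mpoly_fun_eq0 => v.
pose w i := v i - a ord0 i.
pose P := mmap polyC (fun i => (a ord0 i)%:P + w i *: 'X) p.
have P0 : P = 0.
  (* [W] is positive and bounds every coordinate of [w], so that a parameter below [e / W] stays in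
     the ball. *)
  pose W := 1 + \sum_i `|w i|.
  have W1 : 1 <= W by rewrite lerDl sumr_ge0.
  have W0 : 0 < W by rewrite (lt_le_trans ltr01).
  apply: (@poly_eq0_near0 _ _ (e / W)); first by rewrite divr_gt0.
  move=> s /andP[s0 sW]; rewrite horner_mmap.
  transitivity (p.@[(\row_i (a ord0 i + w i * s)) ord0]).
    by apply: meval_eq => i; rewrite mxE hornerD hornerC hornerZ hornerX.
  apply: pX; apply: Xe; split=> // i j; rewrite ord1 mxE /ball /=.
  rewrite opprD addNKr normrN normrM.
  rewrite (gtr0_norm s0); apply: le_lt_trans (_ : W * s < e).
    apply: ler_wpM2r; first exact: ltW.
    rewrite /W (bigD1 j) //= addrCA lerDl addr_ge0 // sumr_ge0 //.
  by rewrite mulrC -ltr_pdivlMr.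
have := horner_mmap (fun i => (a ord0 i)%:P + w i *: 'X) p 1.
rewrite -/P P0 horner0 => ->; apply: meval_eq => i.
by rewrite hornerD hornerC hornerZ hornerX mulr1 addrC subrK.
Qed.

(** The points are chosen so that their vectors of monomials have the largest possible rank. The
    vector of any other point of [X] is then a linear combination of theirs. *)
Lemma determining_points (X : set 'rV[R]_n) d :
  exists (M : nat) (a : 'I_M -> 'rV[R]_n), (forall i, X (a i)) /\
    forall p, (mdegree p <= d)%N -> (forall i, p.@[a i ord0] = 0) ->
      forall x, X x -> p.@[x ord0] = 0.
Proof.
(* The bound of [bmultinom] is strict: these are the monomials of degree at most [d]. *)
pose B : finType := bmultinom n d.+1; pose N := #|B|.
pose mon (x : 'rV[R]_n) : 'rV[R]_N :=
  \row_j (mpolyX R (bmnm (enum_val j))).@[x ord0].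
pose coef p : 'cV[R]_N := \col_j mcoeff (bmnm (enum_val j)) p.
have evE p (x : 'rV[R]_n) : (mdegree p <= d)%N ->
    p.@[x ord0] = (mon x *m coef p) ord0 ord0.
  move=> pd; have pd1 : (mmeasure (@mdeg n) p <= d.+1)%N.
    by move: pd; rewrite /mdegree; case: mmeasure.
  rewrite [p in LHS](mpolywE pd1) raddf_sum mxE /=.
  rewrite (reindex (@enum_val _ (pred_of_simpl (pred_of_argType B)))) /=; last first.
    by apply: onW_bij; apply: enum_val_bij.
  by apply: eq_bigr => j _; rewrite mevalZ !mxE mulrC.
pose good k := `[< exists M (A : 'M[R]_(M, N)),
  (forall i, exists2 x, X x & row i A = mon x) /\ \rank A = k >].
have ex_good : exists k, good k.
  by exists 0%N; apply/asboolP; exists 0%N, 0; split=> [[]//|]; rewrite mxrank0.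
have good_le k : good k -> (k <= N)%N.
  by move=> /asboolP[M [A [_ <-]]]; apply: rank_leq_col.
case: (ex_maxnP ex_good good_le) => k /asboolP[M [A [AX Ak]]] kmax.
have /choice[a aX] : forall i, exists x, X x /\ row i A = mon x.
  by move=> i; have [x Xx Ax] := AX i; exists x.
exists M, a; split=> [i|p pd pa x Xx]; first by have [] := aX i.
have monA : (mon x <= A)%MS.
  have /kmax : good (\rank (col_mx A (mon x))).
    apply/asboolP; exists (M + 1)%N, (col_mx A (mon x)); split=> // i.
    case: (fintype.splitP i) => j ij.
      exists (a j); first by have [] := aX j.
      have -> : i = lshift 1 j by apply: val_inj.
      by rewrite rowKu; have [] := aX j.
    exists x => //; have -> : i = rshift M j by apply: val_inj.
    by rewrite rowKd; apply/rowP => l; rewrite ord1 !mxE.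
  rewrite -addsmxE -Ak => rk.
  have := mxrank_leqif_sup (addsmxSl A (mon x)).
  move=> [le_rk]; rewrite eqn_leq le_rk rk => /esym AmonA.
  exact: submx_trans (addsmxSr _ _) AmonA.
have /submxP[C monE] := monA.
rewrite evE // monE -mulmxA.
have -> : A *m coef p = 0.
  apply/colP => i; rewrite [RHS]mxE -[RHS](pa i) evE //.
  by have [_ <-] := aX i; rewrite -row_mul [RHS]mxE.
by rewrite mulmx0 mxE.
Qed.

End Vanishing.

(** * Feasibility *)

Section Feasibility.
Variables (R : realType) (n l t : nat) (g : 'I_l.+1 -> {mpoly R[n]}) (r : R).
Hypotheses (r0 : 0 <= r) (gE : g ord0 = ball_poly n r).
Local Notation QM := (trunc_qmodule t g).
Local Notation Xm m := (mpolyX R m).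

Lemma sos_degD d (x y : {mpoly R[n]}) :
  sos_deg d x -> sos_deg d y -> sos_deg d (x + y).
Proof.
by move=> [Sx xd] [Sy yd]; split; [exact: is_sosD | exact: mdegreeD_le].
Qed.

Lemma sos_degZ d c (x : {mpoly R[n]}) :
  0 <= c -> sos_deg d x -> sos_deg d (c *: x).
Proof.
move=> c0 [Sx xd]; split; last exact: mdegreeZ_le.
rewrite -mul_mpolyC -(sqr_sqrtr c0) rmorphXn.
by apply: is_sosM => //; apply: is_sos_sqr.
Qed.

Lemma sos_deg0 d : sos_deg d (0 : {mpoly R[n]}).
Proof. by split; [exists [::]; rewrite big_nil | rewrite mdegree0]. Qed.

Lemma sos_deg_sqr d (x : {mpoly R[n]}) :
  (mdegree x <= d)%N -> sos_deg (2 * d) (x ^+ 2).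
Proof. by move=> xd; split; [exact: is_sos_sqr | exact: mdegree_sqr_le]. Qed.

Lemma qmoduleD x y : QM x -> QM y -> QM (x + y).
Proof.
move=> [u [v [Su Sv ->]]] [u' [v' [Su' Sv' ->]]].
exists (u + u'), (fun j => v j + v' j); split; first exact: sos_degD.
  by move=> j; apply: sos_degD.
under [in RHS]eq_bigr do rewrite mulrDl; rewrite big_split /=; ring.
Qed.

Lemma qmoduleZ c x : 0 <= c -> QM x -> QM (c *: x).
Proof.
move=> c0 [u [v [Su Sv ->]]]; exists (c *: u), (fun j => c *: v j); split.
- exact: sos_degZ.
- by move=> j; apply: sos_degZ.
- by rewrite scalerDr scaler_sumr; under eq_bigr do rewrite scalerAl.
Qed.

Lemma qmodule_sqr x : (mdegree x <= t)%N -> QM (x ^+ 2).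
Proof.
move=> xt; exists (x ^+ 2), (fun=> 0); split; first exact: sos_deg_sqr.
  by move=> j; apply: sos_deg0.
by rewrite big1 ?addr0 // => j _; rewrite mul0r.
Qed.

Lemma qmodule0 : QM 0.
Proof.
have -> : 0 = 0 ^+ 2 :> {mpoly R[n]} by rewrite expr0n.
by apply: qmodule_sqr; rewrite mdegree0.
Qed.

Lemma half_degree_ball : (half_degree (ball_poly n r) <= 1)%N.
Proof.
suff : (mdegree (ball_poly n r) <= 2)%N.
  by rewrite /half_degree; case: (mdegree _) => [|[|[|k]]].
apply: mdegreeD_le; first by rewrite mdegreeC.
rewrite mdegreeN; apply: mdegree_sum_le => i _.
by rewrite -[2%N]muln1 mdegree_sqr_le // mdegreeX mdeg1.
Qed.

Lemma qmodule_sqr_ball x : (mdegree x < t)%N -> QM (x ^+ 2 * ball_poly n r).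
Proof.
move=> xt; exists 0, (fun j => if j == ord0 then x ^+ 2 else 0); split.
- exact: sos_deg0.
- move=> j; case: eqP => [->|_]; last exact: sos_deg0.
  apply: sos_deg_sqr; rewrite gE.
  have := half_degree_ball; move: (half_degree _) => k k1.
  by rewrite -ltnS (leq_trans xt) //; lia.
- rewrite (bigD1 ord0) //= ?eqxx gE big1 ?addr0 ?add0r // => j /negbTE ->.
  by rewrite mul0r.
Qed.

(** By induction on the degree. If m = m' + e_i, then r C - x^(2m) is the sum of r (C - x^(2m')), of
    x^(2m') (r - |x|^2) and of the squares of x^m' x_j for j different from i. *)
Lemma qmodule_monomial_sqr m : (mdeg m <= t)%N ->
  exists C, QM (C%:MP - Xm m ^+ 2).
Proof.
move Ed: (mdeg m) => d; elim: d m Ed => [|d IHd] m md dt.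
  have -> : m = mnm0 by apply/eqP; rewrite -mdeg_eq0 md.
  by exists 1; rewrite mpolyX0 expr1n mpolyC1 subrr; exact: qmodule0.
have [i mi] : exists i, (0 < m i)%N.
  apply: contrapT => /forallNP m0; have : mdeg m = 0%N.
    by rewrite mdegE big1 // => i _; apply/eqP; rewrite -leqn0 leqNgt; apply/negP.
  by rewrite md.
pose m' := mnm_sub m (mnm1 i).
have mE : m = mnm_add m' (mnm1 i).
  apply/mnmP => j; rewrite mnmDE mnmBE subnK // mnm1E.
  by case: eqP => // <-.
have m'd : mdeg m' = d.
  by move: md; rewrite mE mdegD mdeg1 addn1 => -[].
have [C QC] := IHd m' m'd (ltnW dt).
exists (r * C).
have -> : (r * C)%:MP - Xm m ^+ 2 = r *: (C%:MP - Xm m' ^+ 2) +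
    (Xm m' ^+ 2 * ball_poly n r + \sum_(j | j != i) (Xm m' * Xm (mnm1 j)) ^+ 2).
  rewrite mE mpolyXD /ball_poly (bigD1 i) //=.
  under [X in _ + (_ + X)]eq_bigr do rewrite exprMn.
  rewrite -mulr_sumr -mul_mpolyC mpolyCM; ring.
apply: qmoduleD; first exact: qmoduleZ.
apply: qmoduleD; first by apply: qmodule_sqr_ball; rewrite mdegreeX m'd.
elim/big_ind: _ => [|x y|j _].
- exact: qmodule0.
- exact: qmoduleD.
- by apply: qmodule_sqr; rewrite -mpolyXD mdegreeX mdegD m'd mdeg1 addn1.
Qed.

Lemma split_monomial (m : multinom n) k : (k <= mdeg m)%N ->
  exists m1 m2, [/\ m = mnm_add m1 m2, mdeg m1 = k & mdeg m2 = (mdeg m - k)%N].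
Proof.
elim: k => [_|k IHk km].
  by exists mnm0, m; rewrite add0m mdeg0 subn0.
have [m1 [m2 [mE m1k m2k]]] := IHk (ltnW km).
have [i m2i] : exists i, (0 < m2 i)%N.
  apply: contrapT => /forallNP m0; have : mdeg m2 = 0%N.
    by rewrite mdegE big1 // => i _; apply/eqP; rewrite -leqn0 leqNgt; apply/negP.
  by rewrite m2k; lia.
exists (mnm_add m1 (mnm1 i)), (mnm_sub m2 (mnm1 i)).
have m2E : m2 = mnm_add (mnm1 i) (mnm_sub m2 (mnm1 i)).
  apply/mnmP => j; rewrite mnmDE mnmBE subnKC // mnm1E.
  by case: eqP => // <-.
split.
- by rewrite mE {1}m2E addmA.
- by rewrite mdegD mdeg1 m1k addn1.
- by move: m2k; rewrite m2E mdegD mdeg1 -m2E; lia.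
Qed.

(** A monomial of degree at most 2t factors as x^m1 x^m2 with both degrees at most t. With e the
    sign of its coefficient a, the polynomial a x^m1 x^m2 + |a| (C1 + C2) / 2 is |a| / 2 times the
    sum of (x^m1 + e x^m2)^2, C1 - x^(2 m1) and C2 - x^(2 m2). *)
Lemma qmodule_shift f : (mdegree f <= 2 * t)%N -> exists C, QM (C%:MP + f).
Proof.
move=> ft.
suff H (F : {mpoly R[n]}) (s : seq (multinom n)) :
    (forall m, m \in s -> (mdeg m <= 2 * t)%N) ->
    exists C, QM (C%:MP + \sum_(m <- s) mcoeff m F *: Xm m).
  have [m /(mdegree_leP _ _ ft)//|C QC] := H f (msupp f).
  by exists C; rewrite -mpolyE in QC.
elim: s => [_|m s IHs ms].
  exists 0; rewrite big_nil mpolyC0 addr0; exact: qmodule0.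
have [m' m's|C QC] := IHs; first by apply: ms; rewrite inE m's orbT.
have mt : (mdeg m <= 2 * t)%N by apply: ms; rewrite mem_head.
have [m1 [m2 [mE m1t m2t]]] : exists m1 m2,
    [/\ m = mnm_add m1 m2, (mdeg m1 <= t)%N & (mdeg m2 <= t)%N].
  have [|m1 [m2 [mE d1 d2]]] := @split_monomial m (minn t (mdeg m)).
    by rewrite geq_minr.
  by exists m1, m2; split=> //; rewrite ?d1 ?d2; move: mt; lia.
have [C1 QC1] := qmodule_monomial_sqr m1t.
have [C2 QC2] := qmodule_monomial_sqr m2t.
set a := mcoeff m F; pose e : R := if 0 <= a then 1 else -1.
have ea : a = `|a| * e.
  rewrite /e; case: (leP 0 a) => a0; first by rewrite ger0_norm ?mulr1.
  by rewrite ltr0_norm // mulrN1 opprK.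
exists (`|a| * (2^-1 * (C1 + C2)) + C).
rewrite big_cons -/a (_ : _ + _ = `|a| *: (2^-1 *: ((Xm m1 + e *: Xm m2) ^+ 2 +
   ((C1%:MP - Xm m1 ^+ 2) + (C2%:MP - Xm m2 ^+ 2)))) +
   (C%:MP + \sum_(m <- s) mcoeff m F *: Xm m)).
  apply: qmoduleD => //; apply: qmoduleZ => //; apply: qmoduleZ.
    by rewrite invr_ge0.
  apply: qmoduleD; last exact: qmoduleD.
  apply: qmodule_sqr; apply: mdegreeD_le; first by rewrite mdegreeX.
  by apply: mdegreeZ_le; rewrite mdegreeX.
have e2 : e * e = 1 by rewrite /e; case: ifP; rewrite ?mulr1 // mulrNN mulr1.
have aE : a%:MP = `|a|%:MP * e%:MP :> {mpoly R[n]} by rewrite -mpolyCM -ea.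
rewrite mE mpolyXD -!mul_mpolyC aE !(mpolyCD, mpolyCM).
have {}e2 : e%:MP * e%:MP = 1 :> {mpoly R[n]} by rewrite -mpolyCM e2 mpolyC1.
have h2 : (2^-1)%:MP * 2%:R = 1 :> {mpoly R[n]}.
  by rewrite -(rmorph_nat (mpolyC n (R:=R))) -mpolyCM mulVf ?mpolyC1 // pnatr_eq0.
move: h2 e2; move: (2^-1)%:MP e%:MP => u v h2 e2.
move: (Xm m1) (Xm m2) (\sum_(_ <- _) _) => x y S.
move: (`|a|)%:MP C%:MP C1%:MP C2%:MP => A D D1 D2.
have -> : (x + v * y) ^+ 2 = x ^+ 2 + 2%:R * (v * x * y) + v * v * y ^+ 2 by ring.
rewrite e2; transitivity (A * (u * (D1 + D2)) + D + (A * (u * 2%:R) * v * x * y + S)).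
  by rewrite h2; ring.
by ring.
Qed.

(** Since the first [h] is 1, the first multiplier [- C] adds the constant [C] to [f]. *)
Lemma feasible_exists s m (p : 'I_s -> {mpoly R[n]}) f
    (h : 'I_m.+1 -> {mpoly R[n]}) : h ord0 = 1 -> (mdegree f <= 2 * t)%N ->
  exists lambda, feasible t p g h f lambda.
Proof.
move=> h1 /qmodule_shift[C QC]; exists (\row_i (if i == ord0 then - C else 0)).
exists (C%:MP + f) => //; exists 0.
  by exists (fun=> 0); split=> [k|]; rewrite ?big1 // => *;
    rewrite mul0r ?mdegree0.
rewrite (bigD1 ord0) //= mxE eqxx h1 big1 => [|i /negbTE i0]; last first.
  by rewrite mxE i0 scale0r.
by rewrite scaleNr -mul_mpolyC mulr1; ring.
Qed.

End Feasibility.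

(** * Moments and the relative interior *)

Lemma continuous_mulr (T : topologicalType) (R : realType) (f g : T -> R) :
  continuous f -> continuous g -> continuous (fun x => f x * g x).
Proof. by move=> fc gc x; exact: cvgM (fc x) (gc x). Qed.

Lemma continuous_subr (T : topologicalType) (R : realType) (f g : T -> R) :
  continuous f -> continuous g -> continuous (fun x => f x - g x).
Proof. by move=> fc gc x; exact: cvgB (fc x) (gc x). Qed.

Lemma continuous_exprn (T : topologicalType) (R : realType) (f : T -> R) k :
  continuous f -> continuous (fun x => f x ^+ k).
Proof.
move=> fc; elim: k => [|k IHk]; first by move=> x; exact: cvg_cst.
by under eq_fun do rewrite exprS; exact: continuous_mulr.
Qed.

Lemma continuous_sum (T : topologicalType) (R : realType) (I : Type) (r : seq I)
    (P : pred I) (F : I -> T -> R) : (forall i, P i -> continuous (F i)) ->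
  continuous (fun x => \sum_(i <- r | P i) F i x).
Proof.
move=> Fc x; elim: r => [|i r IHr].
  by under eq_fun do rewrite big_nil; apply: cvg_cst.
under eq_fun do rewrite big_cons; case: ifP => // Pi.
by apply: cvgD => //; apply: Fc.
Qed.

Lemma continuous_prod (T : topologicalType) (R : realType) (I : Type) (r : seq I)
    (P : pred I) (F : I -> T -> R) : (forall i, P i -> continuous (F i)) ->
  continuous (fun x => \prod_(i <- r | P i) F i x).
Proof.
move=> Fc x; elim: r => [|i r IHr].
  by under eq_fun do rewrite big_nil; apply: cvg_cst.
under eq_fun do rewrite big_cons; case: ifP => // Pi.
by apply: cvgM => //; apply: Fc.
Qed.

Section Moments.
Variables (R : realType) (n : nat).
Implicit Types (p : {mpoly R[n]}) (X : set 'rV[R]_n).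
Local Notation borel := (borel_space R n).

Lemma continuous_meval p : continuous (fun x : 'rV[R]_n => p.@[x ord0]).
Proof.
under eq_fun do rewrite mevalE.
apply: continuous_sum => m _; apply: continuous_mulr.
  exact: cst_continuous.
apply: (@continuous_prod _ _ _ _ _ (fun i (x : 'rV[R]_n) => x ord0 i ^+ m i)) => i _.
apply: continuous_exprn.
exact: coord_continuous.
Qed.

Lemma borel_measurable_open (A : set 'rV[R]_n) :
  open A -> measurable (A : set borel).
Proof. by move=> oA; apply: sub_sigma_algebra. Qed.

Lemma borel_measurable_compact X : compact X -> measurable (X : set borel).
Proof.
move=> cX; rewrite -[X]setCK; apply: measurableC; apply: borel_measurable_open.
by apply: closed_openC; apply: compact_closed => //; apply: norm_hausdorff.
Qed.

Lemma measurable_meval p (D : set borel) : measurable D ->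
  measurable_fun D (fun x : borel => p.@[(x : 'rV[R]_n) ord0]).
Proof.
move=> mD; apply: (@measurability _ _ borel R D _ _
  (measurable_realfun.RGenOInfty.measurableE R)) => _ [_ [c ->] <-].
apply: measurableI => //; apply: borel_measurable_open.
by have /continuousP := @continuous_meval p; apply; exact: interval_open.
Qed.

Lemma integrable_meval (mu : {finite_measure set borel -> \bar R}) X p :
  compact X -> mu.-integrable X (EFin \o (fun x : borel => p.@[(x : 'rV[R]_n) ord0])).
Proof.
move=> cX; have mX := borel_measurable_compact cX.
apply: measurable_bounded_integrable => //.
- by rewrite ltey_eq fin_num_measure.
- exact: measurable_meval.
- have pc : {within X, continuous (fun x : 'rV[R]_n => p.@[x ord0])}.
    by apply: continuous_subspaceT => x; apply: continuous_meval.
  have /compact_bounded[M [_ mrt]] := continuous_compact pc cX.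
  exists M; split; rewrite ?num_real // => y My x Xx /=.
  by apply: (mrt y My); exists x.
Qed.

Variables (m : nat) (h : 'I_m -> {mpoly R[n]}).
Implicit Types (kappa lambda : 'rV[R]_m).

Lemma moment_cone_dirac X a : compact X -> X a ->
  moment_cone h X (\row_i (h i).@[a ord0]).
Proof.
move=> cX Xa; have mX := borel_measurable_compact cX.
pose mu : {finite_measure set borel -> \bar R} := \d_(a : borel).
exists mu.
  by rewrite /measures_on /= /dirac indicE memNset //.
apply/rowP => i; rewrite !mxE /Rintegral integral_dirac //.
  by rewrite diracE mem_set // mul1e.
by apply/measurable_realfun.measurable_EFinP; apply: measurable_meval.
Qed.

Lemma moment_cone_objective X kappa : compact X -> moment_cone h X kappa ->
  exists mu : {finite_measure set borel -> \bar R}, forall lambda,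
    objective kappa lambda = \int[mu]_(x in X)
      (\sum_i lambda ord0 i *: h i).@[(x : 'rV[R]_n) ord0].
Proof.
move=> cX [mu muX <-]; exists mu => lambda.
have mX := borel_measurable_compact cX.
rewrite /objective; under eq_bigr do rewrite mxE mulrC.
elim/big_rec2: _ => [|i y q _ ->].
  under eq_Rintegral do rewrite meval0.
  by rewrite Rintegral_cst // mul0r.
under [in RHS]eq_Rintegral do rewrite mevalD.
rewrite RintegralD //; [|exact: integrable_meval|exact: integrable_meval].
congr (_ + _); under [in RHS]eq_Rintegral do rewrite mevalZ.
by rewrite RintegralZl //; exact: integrable_meval.
Qed.

(** Weak duality: the bound is the integral of [f] against a representing measure of [kappa]. *)
Lemma moment_cone_bound X kappa f : compact X -> moment_cone h X kappa ->
  exists C, forall lambda,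
    (forall x, X x -> 0 <= (f - \sum_i lambda ord0 i *: h i).@[x ord0]) ->
    objective kappa lambda <= C.
Proof.
move=> cX /(moment_cone_objective cX)[mu muE].
exists (\int[mu]_(x in X) f.@[(x : 'rV[R]_n) ord0]) => lambda f_ge.
rewrite muE; apply: le_Rintegral; [exact: borel_measurable_compact
  |exact: integrable_meval|exact: integrable_meval|].
by move=> x /f_ge; rewrite mevalB subr_ge0.
Qed.

(** Consequently the objective at a moment vector depends on [lambda] only through the restriction
    to [X] of the combination of the [h i]. *)
Lemma moment_cone_vanish X kappa lambda : compact X -> moment_cone h X kappa ->
  (forall x, X x -> (\sum_i lambda ord0 i *: h i).@[x ord0] = 0) ->
  objective kappa lambda = 0.
Proof.
move=> cX /(moment_cone_objective cX)[mu ->] h0.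
transitivity (\int[mu]_(x in X) (0 : R)).
  by apply: eq_Rintegral => x; rewrite inE => /h0.
by rewrite Rintegral_cst ?mul0r //; exact: borel_measurable_compact.
Qed.

End Moments.

Lemma relative_interior_sub (R : realType) (m : nat) (K : set 'rV[R]_m) :
  relative_interior K `<=` K.
Proof. by move=> b; exact: (@interior_subset (subspace (affine_hull K)) K b). Qed.

Lemma affine_hull_sub (R : realType) (V : lmodType R) (A : set V) :
  A `<=` affine_hull A.
Proof.
move=> a Aa; exists 1%N, (fun=> 1), (fun=> a).
by rewrite !big_ord1 scale1r; split.
Qed.

(** The vector is [b + e *: w], where [w] is the sum of the differences between [b] and the [k i].
    It is an affine combination of points of [K], with coefficients [1 + e * M%:R] and [- e], and it
    is near [b] when [e] is small. *)
Lemma relative_interior_away (R : realType) (m M : nat) (K : set 'rV[R]_m) b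
    (k : 'I_M -> 'rV[R]_m) :
  relative_interior K b -> (forall i, K (k i)) ->
  exists2 e, 0 < e & K ((1 + e * M%:R) *: b - e *: \sum_i k i).
Proof.
move=> bK kK; have Kb := relative_interior_sub bK.
move: bK; rewrite /relative_interior /interior /= => /nbhs_subspace_ex.
case; first exact: affine_hull_sub.
move=> V bV KV.
pose w := M%:R *: b - \sum_i k i.
have wE e : (1 + e * M%:R) *: b - e *: \sum_i k i = b + e *: w.
  by rewrite /w scalerBr scalerA scalerDl scale1r addrA.
have [d /= d0 Vd] : exists2 d : R, 0 < d & ball b d `<=` V by exact/nbhs_ballP.
(* [W] bounds the coordinates of [w]; the coordinates of [e *: w] are then at most [d / 2]. *)
pose W := 1 + \sum_i `|w ord0 i|.
have W1 : 1 <= W by rewrite lerDl sumr_ge0.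
have W0 : 0 < W by rewrite (lt_le_trans ltr01).
pose e := d / 2 / W; have e0 : 0 < e by rewrite !divr_gt0.
exists e => //; rewrite wE.
suff : (K `&` affine_hull K) (b + e *: w) by case.
rewrite KV; split.
  apply: Vd; split=> // i j; rewrite ord1 2!mxE /ball /=.
  rewrite opprD addNKr normrN normrM.
  rewrite (gtr0_norm e0) (@le_lt_trans _ _ (e * W)) //.
    apply: ler_wpM2l; first exact: ltW.
    by rewrite /W (bigD1 j) //= addrCA lerDl addr_ge0 // sumr_ge0.
  by rewrite /e divfK ?lt0r_neq0 // ltr_pdivrMr // ltr_pMr // ltr1n.
exists M.+1, (fun i => if unlift ord0 i is Some j then - e else 1 + e * M%:R).
exists (fun i => if unlift ord0 i is Some j then k j else b).
split.
- by move=> i; case: unliftP => [j _|_].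
- rewrite big_ord_recl unlift_none; under eq_bigr do rewrite liftK.
  by rewrite sumr_const card_ord -(mulr_natr (- e)) mulNr addrK.
- rewrite big_ord_recl unlift_none; under eq_bigr do rewrite liftK.
  by rewrite -wE -scaler_sumr scaleNr.
Qed.

(** * Caratheodory and compactness *)

Section Caratheodory.
Variables (R : realType) (M N : nat) (A : 'M[R]_(N, M)).

(** The [K.+1] vectors of squares lie in a space of dimension [M <= K], hence satisfy a linear
    relation. Subtracting it leaves nonnegative weights, one of which is zero; the square roots of
    the others are absorbed by the vectors. *)
Lemma sum_squares_reduce K (w : 'I_K.+1 -> 'rV[R]_M) : (M <= K)%N ->
    (forall k, (w k <= A)%MS) ->
  exists w' : 'I_K -> 'rV[R]_M, (forall k, (w' k <= A)%MS) /\
    forall i, \sum_k w' k ord0 i ^+ 2 = \sum_k w k ord0 i ^+ 2.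
Proof.
move=> MK wA; pose Z : 'M[R]_(K.+1, M) := \matrix_(k, i) w k ord0 i ^+ 2.
have kerZ : kermx Z != 0.
  rewrite kermx_eq0 /row_free neq_ltn ltnS.
  by rewrite (leq_trans (rank_leq_col Z)).
pose c := nz_row (kermx Z).
have c0 : c != 0 by rewrite nz_row_eq0.
have cZ : c *m Z = 0 by apply/sub_kermxP/nz_row_sub.
have [k1 ck1] : exists k, c ord0 k != 0 by apply/rV0Pn.
(* Dividing the relation by a coefficient of largest absolute value makes all coefficients at most
   1, with equality at [k2], whose vector is dropped. *)
pose k2 := [arg max_(k > k1) `|c ord0 k|]%O.
have k2max k : `|c ord0 k| <= `|c ord0 k2|.
  by rewrite /k2; case: arg_maxP => // i _ /(_ k isT).
have ck2 : c ord0 k2 != 0.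
  by rewrite -normr_gt0 (lt_le_trans _ (k2max k1)) // normr_gt0.
pose e k := c ord0 k / c ord0 k2.
have e_le k : 0 <= 1 - e k.
  rewrite subr_ge0 (le_trans (ler_norm _)) // normrM normfV.
  by rewrite ler_pdivrMr ?mul1r ?k2max // normr_gt0.
have eZ i : \sum_k e k * w k ord0 i ^+ 2 = 0.
  have cZi : \sum_k c ord0 k * w k ord0 i ^+ 2 = 0.
    transitivity ((c *m Z) ord0 i); last by rewrite cZ mxE.
    by rewrite mxE; apply: eq_bigr => k _; rewrite [Z _ _]mxE.
  transitivity ((\sum_k c ord0 k * w k ord0 i ^+ 2) / c ord0 k2).
    by rewrite mulr_suml; apply: eq_bigr => k _; rewrite /e; ring.
  by rewrite cZi mul0r.
exists (fun j => Num.sqrt (1 - e (lift k2 j)) *: w (lift k2 j)); split=> [k|i].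
  by rewrite scalemx_sub.
transitivity (\sum_k (1 - e k) * w k ord0 i ^+ 2).
  rewrite [RHS](bigD1_ord k2) //= /e divff // subrr mul0r add0r.
  apply: eq_bigr => j _; rewrite mxE exprMn sqr_sqrtr //; exact: e_le.
under eq_bigr do rewrite mulrBl mul1r.
by rewrite sumrB eZ subr0.
Qed.

(** Longer families are reduced and shorter ones are padded with zeros. With exactly [M] squares,
    all families live in one finite-dimensional space. *)
Lemma sum_squares_caratheodory K (w : 'I_K -> 'rV[R]_M) :
    (forall k, (w k <= A)%MS) ->
  exists w' : 'I_M -> 'rV[R]_M, (forall k, (w' k <= A)%MS) /\
    forall i, \sum_k w' k ord0 i ^+ 2 = \sum_k w k ord0 i ^+ 2.
Proof.
elim: K w => [|K IHK] w wA.
  exists (fun=> 0); split=> [k|i]; first exact: sub0mx.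
  by rewrite big_ord0 big1 // => k _; rewrite mxE expr0n.
have [MK|KM] := leqP M K.
  have [w1 [w1A w1E]] := sum_squares_reduce MK wA.
  have [w2 [w2A w2E]] := IHK _ w1A.
  by exists w2; split=> // i; rewrite w2E.
exists (fun i => if insub (val i) is Some k then w k else 0); split=> [k|i].
  by case: insub => [j|]; rewrite ?sub0mx.
rewrite -(big_mkord xpredT (fun k => (if insub k is Some j then w j else 0)
  ord0 i ^+ 2)) (big_cat_nat _ (n := K.+1)) //= [X in _ + X]big_nat.
rewrite [X in _ + X]big1 ?addr0 => [|k /andP[Kk _]]; last first.
  by rewrite insubN ?mxE ?expr0n // -leqNgt.
by rewrite big_mkord; apply: eq_bigr => k _; rewrite valK.
Qed.

End Caratheodory.

(** The rows of [A] are the weighted vectors of values of the monomials of degree at most [d]. *)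
Lemma evaluation_space (R : realType) (n M d : nat) (a : 'I_M -> 'rV[R]_n)
    (c : 'I_M -> R) : exists N (A : 'M[R]_(N, M)), forall w : 'rV[R]_M,
  (w <= A)%MS <-> exists2 q : {mpoly R[n]}, (mdegree q <= d)%N &
    w = \row_i (c i * q.@[a i ord0]).
Proof.
pose B : finType := bmultinom n d.+1; pose N := #|B|.
exists N, (\matrix_(j, i) (c i * (mpolyX R (bmnm (enum_val j))).@[a i ord0])).
move=> w; split=> [/submxP[D ->]|[q qd ->]].
  exists (\sum_j D ord0 j *: mpolyX R (bmnm (enum_val j))).
    apply: mdegree_sum_le => j _; apply: mdegreeZ_le; rewrite mdegreeX.
    by rewrite -ltnS bmdeg.
  apply/rowP => i; rewrite !mxE raddf_sum mulr_sumr; apply: eq_bigr => j _.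
  by rewrite mxE /= mevalZ; ring.
have qd1 : (mmeasure (@mdeg n) q <= d.+1)%N.
  by move: qd; rewrite /mdegree; case: mmeasure.
apply/submxP; exists (\row_j mcoeff (bmnm (enum_val j)) q).
apply/rowP => i; rewrite !mxE [q in LHS](mpolywE qd1) raddf_sum mulr_sumr /=.
rewrite (reindex (@enum_val _ (pred_of_simpl (pred_of_argType B)))) /=; last first.
  by apply: onW_bij; apply: enum_val_bij.
by apply: eq_bigr => j _; rewrite mevalZ !mxE; ring.
Qed.

(** * Maximization over a compact set of families of squares *)

Section CompactMaximum.
Variables (R : realType) (J M m : nat) (N : 'I_J -> nat).
Variables (A : forall j, 'M[R]_(N j, M)) (H : 'M[R]_(m, M)) (y : 'rV[R]_M).
Variables (b : 'rV[R]_m) (C : R).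

Definition square_sum (w : 'I_J -> 'I_M -> 'rV[R]_M) : 'rV[R]_M :=
  \row_i \sum_j \sum_k w j k ord0 i ^+ 2.

(** In the application [y] holds the values of [f] at the points and the rows of [H] those of the
    [h i]. The second condition then provides multipliers, and the third makes the set bounded. *)
Definition admissible (w : 'I_J -> 'I_M -> 'rV[R]_M) : Prop :=
  [/\ forall j k, (w j k <= A j)%MS, (y - square_sum w <= H)%MS
    & forall i, square_sum w ord0 i <= C].

(** [pinvmx H] selects multipliers that depend linearly, hence continuously, on the vector to be
    represented. *)
Let value w := objective b ((y - square_sum w) *m pinvmx H).

Lemma admissible_max : (exists w, admissible w) ->
  exists2 w, admissible w & forall w', admissible w' -> value w' <= value w.
Proof.
(* Families of vectors are identified with row vectors of length [D], where closed bounded sets are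
   compact. *)
pose T : finType := ('I_J * 'I_M * 'I_M)%type; pose D := #|T|.
pose ww (z : 'rV[R]_D) j k : 'rV[R]_M := \row_i z ord0 (enum_rank (j, k, i)).
pose zz (w : 'I_J -> 'I_M -> 'rV[R]_M) : 'rV[R]_D :=
  \row_x let: (j, k, i) := enum_val x in w j k ord0 i.
have zzK w : ww (zz w) = w.
  apply/funext => j; apply/funext => k; apply/rowP => i.
  by rewrite !mxE enum_rankK.
pose Z := [set z | admissible (ww z)].
have coord x : continuous (fun z : 'rV[R]_D => z ord0 x).
  exact: coord_continuous.
have sumc i : continuous (fun z : 'rV[R]_D => square_sum (ww z) ord0 i).
  under eq_fun do rewrite mxE; apply: continuous_sum => j _.
  apply: continuous_sum => k _; apply: continuous_exprn.
  under eq_fun do rewrite mxE; exact: coord.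
have yc i : continuous (fun z : 'rV[R]_D => (y - square_sum (ww z)) ord0 i).
  under eq_fun do rewrite mxE [X in _ + X]mxE.
  by apply: continuous_subr; [exact: cst_continuous | exact: sumc].
have subc N' (B : 'M[R]_(N', M)) (v : 'rV[R]_D -> 'rV[R]_M) :
    (forall i, continuous (fun z => v z ord0 i)) ->
    closed [set z | (v z <= B)%MS].
  move=> vc.
  rewrite (_ : [set _ | _] = \bigcap_k [set z | (v z *m cokermx B) ord0 k = 0]).
    apply: closed_bigI => k _.
    apply: (closed_comp (f := fun z => (v z *m cokermx B) ord0 k) (D := [set 0])).
      move=> z _; under eq_fun do rewrite mxE; apply: continuous_sum => i _.
      by apply: continuous_mulr => //; exact: cst_continuous.
    exact: closed_eq.
  apply/seteqP; split=> z; rewrite /= submxE => /=.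
    by move=> /eqP vB k _; rewrite /= vB mxE.
  by move=> vB; apply/eqP/rowP => k; rewrite [RHS]mxE; exact: vB.
have Zc : compact Z.
  apply: bounded_closed_compact; last first.
    rewrite (_ : Z = (\bigcap_j \bigcap_k [set z | (ww z j k <= A j)%MS]) `&`
      ([set z | (y - square_sum (ww z) <= H)%MS] `&`
      \bigcap_i [set z | square_sum (ww z) ord0 i <= C])).
      apply: closedI; last apply: closedI.
      - apply: closed_bigI => j _; apply: closed_bigI => k _; apply: subc => i.
        under eq_fun do rewrite mxE; exact: coord.
      - exact: subc.
      - apply: closed_bigI => i _.
        apply: (closed_comp (f := fun z => square_sum (ww z) ord0 i)
          (D := [set u | u <= C])); last exact: closed_le.
        by move=> z _; apply: sumc.
    apply/seteqP; split=> z /=.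
      by case=> zA zH zC; split; [move=> j _ k _|split=> // i _]; rewrite /=.
    case=> zA [zH zC]; split=> // [j k|i]; first exact: (zA j I k I).
    exact: (zC i I).
  exists (`|C| + 1); split; first exact: num_real.
  move=> B CB z [zA zH zC] /=; apply: le_trans (ltW CB).
  rewrite [leLHS]/Num.norm /= mx_normrE; apply: bigmax_le => [|[i0 x] _] /=.
    by rewrite addr_ge0.
  rewrite ord1 {i0}; have : z ord0 x ^+ 2 <= C.
    case E : (enum_val x) => [[j k] i].
    apply: le_trans (zC i); rewrite mxE (bigD1 j) //= (bigD1 k) //=.
    rewrite mxE -E enum_valK -addrA lerDl addr_ge0 // sumr_ge0 // => *.
      exact: sqr_ge0.
    by apply: sumr_ge0 => *; exact: sqr_ge0.
  (* As 2 u <= u^2 + 1, a bound u^2 <= C on a nonnegative u entails u <= |C| + 1. *)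
  rewrite -real_normK ?num_real // => zC2.
  have := sqr_ge0 (`|z ord0 x| - 1); have := ler_norm C.
  move: zC2 (normr_ge0 C); set u := `|z ord0 x|; set c := `|C|.
  by rewrite expr2 [(u - 1) ^+ 2]expr2; nra.
case=> w0 w0P.
have Z0 : Z !=set0 by exists (zz w0); rewrite /Z /= zzK.
have Fc : {within Z, continuous (fun z => value (ww z))}.
  apply: continuous_subspaceT; rewrite /value /objective.
  apply: continuous_sum => k _; apply: continuous_mulr.
    exact: cst_continuous.
  under eq_fun do rewrite mxE; apply: continuous_sum => i _.
  by apply: continuous_mulr => //; exact: cst_continuous.
have [z] := EVT_max_rV Z0 Zc Fc; rewrite inE => zZ zmax.
exists (ww z) => // w' w'P; rewrite -(zzK w'); apply: zmax.
by rewrite inE /Z /= zzK.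
Qed.

End CompactMaximum.

(** * Attainment *)

Lemma half_degree_le (R : realType) n (q : {mpoly R[n]}) t :
  (half_degree q <= t)%N -> (mdegree q <= 2 * t)%N.
Proof.
rewrite /half_degree uphalf_half => qt; rewrite -[mdegree q]odd_double_half.
by move: qt; case: odd; rewrite -mul2n /=; lia.
Qed.

Section Cases.
Variables (R : realType) (n s l : nat).
Variables (p : 'I_s -> {mpoly R[n]}) (g : 'I_l.+1 -> {mpoly R[n]}).
Hypothesis cases : variety_case p g \/ interior_case p g (semialg_set p g).

Lemma cases_ball : exists2 r, 0 <= r & g ord0 = ball_poly n r.
Proof. by case: cases => -[_ ]; [|move=> _]; case=> r /ltW r0 gE; exists r. Qed.

Lemma vanishing_trunc_ideal t q : (mdegree q <= 2 * t)%N ->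
  (forall x, semialg_set p g x -> q.@[x ord0] = 0) -> trunc_ideal t p q.
Proof.
move=> qt qX; case: cases => [[l0 _ Vg rad Gp]|[_ p0 _ X0]]; last first.
  rewrite (mpoly_interior_eq0 X0 qX); exists (fun=> 0).
  by split=> [k|]; rewrite ?big1 // => *; rewrite mul0r ?mdegree0.
apply: groebner_trunc_ideal => //; rewrite rad /=.
have [x px|a [sigma [Ssigma Iq]]] := @real_nullstellensatz _ _ _ p q.
  rewrite (_ : x = (\row_i x i) ord0); last by apply/funext => i; rewrite mxE.
  have px' k : (p k).@[(\row_i x i) ord0] = 0.
    by rewrite -[RHS](px k); apply: meval_eq => i; rewrite mxE.
  apply: qX; split=> // j; have -> : j = ord0.
    by apply: val_inj => /=; move: (ltn_ord j); rewrite [X in (_ < X.+1)%N]l0; lia.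
  exact/ltW/Vg.
(* The Nullstellensatz may yield [a = 0], whereas real radicality asks for a positive exponent:
   everything is multiplied by [q ^+ 2]. *)
exists a.+1, (q ^+ 2 * sigma); split=> //.
  by apply: is_sosM => //; apply: is_sos_sqr.
by rewrite mulnS exprD -mulrDr; apply: ideal_genMl.
Qed.

End Cases.

(** * Feasibility in terms of values at determining points, and existence of a maximizer *)

Section Attainment.
Variables (R : realType) (n m s l t M : nat) (f : {mpoly R[n]}).
Variables (h : 'I_m.+1 -> {mpoly R[n]}) (p : 'I_s -> {mpoly R[n]}).
Variables (g : 'I_l.+1 -> {mpoly R[n]}) (a : 'I_M -> 'rV[R]_n).
Local Notation X := (semialg_set p g).
Hypotheses (ft : (mdegree f <= 2 * t)%N)
  (ht : forall i, (mdegree (h i) <= 2 * t)%N)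
  (gt : forall j, (half_degree (g j) <= t)%N).
Hypothesis aX : forall i, X (a i).
Hypothesis a_det : forall q : {mpoly R[n]}, (mdegree q <= 2 * t)%N ->
  (forall i, q.@[a i ord0] = 0) -> forall x, X x -> q.@[x ord0] = 0.
Hypothesis X_ideal : forall q : {mpoly R[n]}, (mdegree q <= 2 * t)%N ->
  (forall x, X x -> q.@[x ord0] = 0) -> trunc_ideal t p q.

(* [gg ord0] is the multiplier [1] of [sigma0] in the quadratic module. *)
Let gg (j : 'I_l.+2) : {mpoly R[n]} :=
  if unlift ord0 j is Some k then g k else 1.
Let dd j := (t - half_degree (gg j))%N.
(** Weighting the values of [q] by these roots turns the values of [q ^+ 2 * gg j] into squares;
    [gg j] is nonnegative at the points [a i] because they belong to [X]. *)
Let gamma j i := Num.sqrt (gg j).@[a i ord0].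
Let ev (q : {mpoly R[n]}) : 'rV[R]_M := \row_i q.@[a i ord0].
Let H : 'M[R]_(m.+1, M) := \matrix_(k, i) (h k).@[a i ord0].

Let gg0 : gg ord0 = 1. Proof. by rewrite /gg unlift_none. Qed.
Let ggS k : gg (lift ord0 k) = g k. Proof. by rewrite /gg liftK. Qed.

Let dd0 : dd ord0 = t.
Proof. by rewrite /dd gg0 /half_degree -mpolyC1 mdegreeC subn0. Qed.

Let gg_ge0 j i : 0 <= (gg j).@[a i ord0].
Proof.
have [_ ga] := aX i; case: (unliftP ord0 j) => [k ->|->]; first by rewrite ggS.
by rewrite gg0 -mpolyC1 mevalC.
Qed.

Let N_A : exists NA : 'I_l.+2 -> {N : nat & 'M[R]_(N, M)},
  forall j (w : 'rV[R]_M), (w <= projT2 (NA j))%MS <->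
    exists2 q : {mpoly R[n]}, (mdegree q <= dd j)%N &
      w = \row_i (gamma j i * q.@[a i ord0]).
Proof.
suff : forall j, exists NA : {N : nat & 'M[R]_(N, M)}, forall w : 'rV[R]_M,
    (w <= projT2 NA)%MS <-> exists2 q : {mpoly R[n]}, (mdegree q <= dd j)%N &
      w = \row_i (gamma j i * q.@[a i ord0]).
  by move=> /choice[NA NAP]; exists NA.
move=> j; have [N [A AP]] := evaluation_space (dd j) a (gamma j).
by exists (existT _ N A).
Qed.

Let ev_lambda (lambda : 'rV[R]_m.+1) :
  ev (\sum_i lambda ord0 i *: h i) = lambda *m H.
Proof.
apply/rowP => i; rewrite !mxE raddf_sum; apply: eq_bigr => k _.
by rewrite mxE /= mevalZ.
Qed.

Let fh_degree (lambda : 'rV[R]_m.+1) :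
  (mdegree (f - \sum_i lambda ord0 i *: h i)%R <= 2 * t)%N.
Proof.
apply: mdegreeD_le => //; rewrite mdegreeN; apply: mdegree_sum_le => i _.
exact: mdegreeZ_le.
Qed.

Lemma feasible_ge0 lambda x : feasible t p g h f lambda -> X x ->
  0 <= (f - \sum_i lambda ord0 i *: h i).@[x ord0].
Proof.
move=> [u [s0 [sg [[S0 _] Sg ->]]] [v [k [_ ->]] <-]] [px gx].
have sos_ge0 (q : {mpoly R[n]}) : is_sos q -> 0 <= q.@[x ord0].
  move=> [qs ->]; rewrite raddf_sum sumr_ge0 // => q' _.
  by rewrite /= rmorphXn sqr_ge0.
rewrite !mevalD !raddf_sum /= [X in _ + X]big1 ?addr0 => [|i _]; last first.
  by rewrite mevalM px mulr0.
rewrite addr_ge0 ?sos_ge0 // sumr_ge0 // => j _.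
by rewrite mevalM mulr_ge0 // sos_ge0 //; have [] := Sg j.
Qed.

Section Factor.
Variable NA : 'I_l.+2 -> {N : nat & 'M[R]_(N, M)}.
Hypothesis NAP : forall j (w : 'rV[R]_M), (w <= projT2 (NA j))%MS <->
    exists2 q : {mpoly R[n]}, (mdegree q <= dd j)%N &
      w = \row_i (gamma j i * q.@[a i ord0]).

(** At the points [a i] the ideal part vanishes, and each weighted sum of squares becomes a sum of
    squared vectors. The degrees of the polynomials squared are bounded because leading squares do
    not cancel. *)
Lemma feasible_square_sum lambda : feasible t p g h f lambda ->
  exists2 w : 'I_l.+2 -> 'I_M -> 'rV[R]_M,
    forall j k, (w j k <= projT2 (NA j))%MS &
    ev f - square_sum w = lambda *m H.
Proof.
move=> [u [s0 [sg [S0 Sg uE]]] [v [k [_ vE]] uv]].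
pose ss j : {mpoly R[n]} := if unlift ord0 j is Some k then sg k else s0.
have Sss j : sos_deg (2 * dd j) (ss j).
  case: (unliftP ord0 j) => [i ->|->].
    by rewrite /ss liftK /dd ggS; exact: Sg.
  by rewrite /ss unlift_none dd0.
have : forall j, exists w : 'I_M -> 'rV[R]_M,
    (forall k, (w k <= projT2 (NA j))%MS) /\
    forall i, \sum_k w k ord0 i ^+ 2 = (gg j).@[a i ord0] * (ss j).@[a i ord0].
  move=> j; have [[qs ssE] ssd] := Sss j; rewrite ssE in ssd.
  pose w (k : 'I_(size qs)) : 'rV[R]_M :=
    \row_i (gamma j i * (qs`_k).@[a i ord0]).
  have [|w' [w'A w'E]] := @sum_squares_caratheodory _ _ _ (projT2 (NA j)) _ w.
    move=> i; apply/NAP; exists qs`_i => //.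
    by apply: (sos_term_mdegree ssd); rewrite mem_nth.
  exists w'; split=> // i; rewrite w'E ssE (big_nth 0) big_mkord raddf_sum.
  rewrite mulr_sumr; apply: eq_bigr => r _.
  by rewrite mxE exprMn /gamma sqr_sqrtr // /= rmorphXn.
move=> /choice[w wP]; exists w => [j r|]; first by have [] := wP j.
apply/rowP => i; rewrite -ev_lambda !mxE.
under eq_bigr => j _ do rewrite (wP j).2.
rewrite big_ord_recl gg0 /ss unlift_none; under eq_bigr do rewrite ggS liftK.
have -> : f = u + v + \sum_i lambda ord0 i *: h i by rewrite uv subrK.
rewrite !mevalD uE vE mevalD !raddf_sum /=.
rewrite [X in _ + X + _ - _]big1 => [|r _]; last first.
  by have [pa _] := aX i; rewrite mevalM pa mulr0.
under [X in _ + X + _ + _ - _]eq_bigr do rewrite mevalM mulrC.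
by rewrite -mpolyC1 mevalC; ring.
Qed.

(** The vectors come from polynomials whose squares make up an element [u] of the quadratic module.
    What remains vanishes at the points [a i], hence on [X], hence belongs to the truncated
    ideal. *)
Lemma square_sum_feasible lambda (w : 'I_l.+2 -> 'I_M -> 'rV[R]_M) :
  (forall j k, (w j k <= projT2 (NA j))%MS) ->
  ev f - square_sum w = lambda *m H -> feasible t p g h f lambda.
Proof.
move=> wA wE.
have : forall jk, exists q : {mpoly R[n]}, (mdegree q <= dd jk.1)%N /\
    w jk.1 jk.2 = \row_i (gamma jk.1 i * q.@[a i ord0]).
  by move=> [j k] /=; have /NAP[q qd ->] := wA j k; exists q.
move=> /choice[q qP].
pose ss j := \sum_k q (j, k) ^+ 2.
have Sss j : sos_deg (2 * dd j) (ss j).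
  split; first by exists [seq q (j, k) | k <- enum 'I_M]; rewrite big_map big_enum.
  apply: mdegree_sum_le => k _; apply: mdegree_sqr_le.
  by have [] := qP (j, k).
pose u := \sum_j ss j * gg j.
have ud : (mdegree u <= 2 * t)%N.
  apply: mdegree_sum_le => j _; have [_ sd] := Sss j.
  have gd : (mdegree (gg j) <= 2 * half_degree (gg j))%N by exact: half_degree_le.
  apply: leq_trans (mdegreeM_le sd gd) _; rewrite /dd -mulnDr subnK //.
  case: (unliftP ord0 j) => [k ->|->]; first by rewrite ggS.
  by rewrite gg0 /half_degree -mpolyC1 mdegreeC.
have uE i : u.@[a i ord0] = square_sum w ord0 i.
  rewrite mxE raddf_sum; apply: eq_bigr => j _; rewrite /= mevalM raddf_sum.
  rewrite mulr_suml; apply: eq_bigr => k _; have [_ /= ->] := qP (j, k).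
  by rewrite mxE exprMn /gamma sqr_sqrtr // rmorphXn mulrC.
exists u.
  exists (ss ord0), (fun k => ss (lift ord0 k)); split.
  - by rewrite -dd0; exact: Sss.
  - by move=> k; have := Sss (lift ord0 k); rewrite /dd ggS.
  - rewrite /u big_ord_recl gg0 mulr1; congr (_ + _).
    by apply: eq_bigr => k _; rewrite ggS.
exists (f - \sum_i lambda ord0 i *: h i - u); last by rewrite addrC subrK.
have fhu : (mdegree (f - \sum_i lambda ord0 i *: h i - u)%R <= 2 * t)%N.
  by apply: mdegreeD_le; rewrite ?mdegreeN.
apply: X_ideal => //; apply: a_det => // i.
rewrite !mevalB uE; have := congr1 (fun v : 'rV_M => v ord0 i) wE.
by rewrite -ev_lambda !mxE => <-; ring.
Qed.

End Factor.

Let objectiveB (b l1 l2 : 'rV[R]_m.+1) :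
  objective b (l1 - l2) = objective b l1 - objective b l2.
Proof.
by rewrite /objective -sumrB; apply: eq_bigr => i _; rewrite !mxE mulrBr.
Qed.

Let objective_away (b lambda : 'rV[R]_m.+1) (e : R) :
  objective ((1 + e * M%:R) *: b - e *: \sum_i \row_j (h j).@[a i ord0]) lambda
  = (1 + e * M%:R) * objective b lambda -
    e * \sum_i (\sum_j lambda ord0 j *: h j).@[a i ord0].
Proof.
have -> : \sum_i (\sum_j lambda ord0 j *: h j).@[a i ord0] =
    \sum_j (\sum_i (h j).@[a i ord0]) * lambda ord0 j.
  under eq_bigr do rewrite raddf_sum; rewrite exchange_big; apply: eq_bigr => j _.
  by rewrite mulr_suml; apply: eq_bigr => i _; rewrite /= mevalZ mulrC.
rewrite /objective !mulr_sumr -sumrB; apply: eq_bigr => j _.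
rewrite !mxE summxE; under [in LHS]eq_bigr do rewrite mxE; ring.
Qed.

Lemma optimum_attained (b : 'rV[R]_m.+1) : compact X ->
    relative_interior (moment_cone h X) b ->
    (exists lambda, feasible t p g h f lambda) ->
  exists2 lambda, feasible t p g h f lambda & forall lambda',
    feasible t p g h f lambda' -> objective b lambda' <= objective b lambda.
Proof.
move=> cX bK [lambda0 F0]; have [NA NAP] := N_A.
have Kb := relative_interior_sub bK.
have [e e0 Ke] := relative_interior_away bK
  (fun i => moment_cone_dirac h cX (aX i)).
have [C' C'P] := moment_cone_bound f cX Ke.
(* The rows of [H] may be dependent, so that [lambda *m H] need not determine [lambda]. It
   determines the objective: a combination of the [h i] that is zero at the points is zero on [X],
   and [b] is a moment vector. *)
have obj_eq l1 l2 : l1 *m H = l2 *m H -> objective b l1 = objective b l2.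
  move=> l12; apply/eqP; rewrite -subr_eq0 -objectiveB; apply/eqP.
  apply: (moment_cone_vanish cX Kb); apply: a_det => [|i].
    by apply: mdegree_sum_le => i _; exact: mdegreeZ_le.
  have := congr1 (fun v : 'rV_M => v ord0 i) (ev_lambda (l1 - l2)).
  by rewrite mulmxBl l12 subrr !mxE.
pose v0 := objective b lambda0.
(* For a feasible [l1] of objective at least [v0], the bound [C'] at the displaced moment vector
   shows that [e] times the sum over the points of the values of [f - \sum_j l1 ord0 j *: h j] is at
   most [C' + e * (\sum_i f.@[a i ord0]) - (1 + e * M%:R) * v0]. These values are nonnegative, so
   that each is at most [C]. *)
pose C := (C' + e * (\sum_i f.@[a i ord0]) - (1 + e * M%:R) * v0) / e.
pose adm := admissible (fun j => projT2 (NA j)) H (ev f) C.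
pose lam (w : 'I_l.+2 -> 'I_M -> 'rV[R]_M) := (ev f - square_sum w) *m pinvmx H.
have lamH w : adm w -> lam w *m H = ev f - square_sum w.
  by case=> _ wH _; rewrite /lam mulmxKpV.
have adm_of l1 : feasible t p g h f l1 -> v0 <= objective b l1 ->
    exists2 w, adm w & objective b (lam w) = objective b l1.
  move=> Fl vl; have [w wA wE] := feasible_square_sum NAP Fl.
  have ssE i : square_sum w ord0 i = (f - \sum_j l1 ord0 j *: h j).@[a i ord0].
    have := congr1 (fun v : 'rV_M => v ord0 i) wE.
    by rewrite -ev_lambda mevalB !mxE => <-; ring.
  have wadm : adm w.
    split=> // [|i]; first by rewrite wE submxMl.
    apply: (@le_trans _ _ (\sum_i square_sum w ord0 i)).
      rewrite (bigD1 i) //= lerDl sumr_ge0 // => k _; rewrite ssE.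
      exact: feasible_ge0.
    have := C'P l1 (fun x => feasible_ge0 Fl).
    rewrite objective_away /C ler_pdivlMr // [_ * e]mulrC.
    have -> : \sum_i square_sum w ord0 i = \sum_i f.@[a i ord0] -
        \sum_i (\sum_j l1 ord0 j *: h j).@[a i ord0].
      by rewrite -sumrB; apply: eq_bigr => k _; rewrite ssE mevalB.
    have : (1 + e * M%:R) * v0 <= (1 + e * M%:R) * objective b l1.
      by rewrite ler_wpM2l // addr_ge0 // mulr_ge0 // ltW.
    by rewrite mulrBr; lra.
  by exists w => //; apply: obj_eq; rewrite lamH.
have [w0 w0adm w0E] := adm_of _ F0 (lexx _).
have [w wadm wmax] := @admissible_max _ _ _ _ _ _ H (ev f) b C (ex_intro _ w0 w0adm).
exists (lam w).
  by apply: (square_sum_feasible NAP (w := w)); [case: wadm | rewrite lamH].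
move=> l1 Fl; have [lv|vl] := ltP (objective b l1) v0.
  apply: le_trans (ltW lv) _; rewrite /v0 -w0E; exact: wmax.
by have [w1 w1adm <-] := adm_of _ Fl vl; exact: wmax.
Qed.

End Attainment.

(** The supremum is taken in the extended reals: equality with the objective at a feasible point
    says at once that it is finite and attained. *)
Theorem theorem1p3 (R : realType) (n m s l : nat)
    (f : {mpoly R[n]}) (h : 'I_m.+1 -> {mpoly R[n]}) (b : 'rV[R]_m.+1)
    (p : 'I_s -> {mpoly R[n]}) (g : 'I_l.+1 -> {mpoly R[n]})
    (X : set 'rV[R]_n) (X_compact : compact X) (XE : X = semialg_set p g)
    (cases : variety_case p g \/ interior_case p g X)
    (h1 : h ord0 = 1) (b1_gt0 : 0 < b ord0 ord0)
    (b_relint : relative_interior (moment_cone h X) b)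
    (t : nat) (t_ge : (t_min p g h f <= t)%N) :
  exists2 lambda, feasible t p g h f lambda
    & (objective b lambda)%:E = sdp_value t p g h f b.
Proof.
subst X.
have [gt ht ft] : [/\ forall j, (half_degree (g j) <= t)%N,
    forall i, (half_degree (h i) <= t)%N & (half_degree f <= t)%N].
  move: t_ge; rewrite /t_min !geq_max => /andP[/andP[g_t _] /andP[h_t f_t]].
  split=> [j|j|//]; [apply: leq_trans g_t|apply: leq_trans h_t].
    exact: (leq_bigmax (F := fun j => half_degree (g j))).
  exact: (leq_bigmax (F := fun j => half_degree (h j))).
have [r r0 gE] := cases_ball cases.
have [M [a [aX a_det]]] := determining_points (semialg_set p g) (2 * t).
have [||||lambda Fl lmax] := @optimum_attained R n m s l t M f h p g a _ _ gt aX
  a_det _ b X_compact b_relint.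
- exact: half_degree_le.
- by move=> i; exact: half_degree_le.
- by move=> q; exact: vanishing_trunc_ideal.
- by apply: (feasible_exists r0 gE) => //; exact: half_degree_le.
exists lambda => //; apply/eqP; rewrite eq_le; apply/andP; split.
  by apply: ereal_sup_ubound; exists lambda.
by apply: ge_ereal_sup => _ [l' Fl' <-]; rewrite lee_fin lmax.
Qed.
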